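(* For every integer $r\ge0$ one has $O_{u(r)}(\tau-\star)(V)\subset u\sigma(V*V)$; that is, $O_{u(r)}\bigl(\tau(v)-\star(v)\bigr)\in u\sigma(V*V)$ for all $v\in V$.
   Context: A multi-index is a nonempty finite sequence $\mu=(\mu_1,\ldots,\mu_p)$ of positive integers, of length $l(\mu)=p$ and weight $|\mu|=\sum\mu_i$; $\phi$ is the empty multi-index. $V$ is the $\mathbb{Q}$-vector space with basis the set of all nonempty multi-indices and $\tilde V=\mathbb{Q}\phi\oplus V$. For $m\ge1$ and $\mu$ of weight $m$ put $\mathcal{S}_m(\mu)=\{\mu_1+\cdots+\mu_k:1\le k<p\}\subset\{1,\ldots,m-1\}$ ($\mathcal{S}_m$ is a bijection from multi-indices of weight $m$ onto subsets of $\{1,\ldots,m-1\}$). For multi-indices of equal weight $m$, $\nu\ge\mu$ means $\mathcal{S}_m(\nu)\supset\mathcal{S}_m(\mu)$. Define linear maps on $V$ by: $\star(\mu)=\mu^*$, the multi-index with $\mathcal{S}_m(\mu^* )=\{1,\ldots,m-1\}\setminus\mathcal{S}_m(\mu)$ (the paper denotes this map by $*$); $\tau(\mu_1,\ldots,\mu_p)=(\mu_p,\ldots,\mu_1)$; $\sigma(\mu)=(-1)^{l(\mu)}\mu$; $u(\mu)=\sum_{\nu\ge\mu}\nu$. All of these send $\phi$ to $\phi$. For a multi-index $\mu=(\mu_1,\ldots,\mu_p)$, $O_\mu\colon\tilde V\to\tilde V$ is the linear map with $O_\mu(\phi)=0$ and $$O_\mu(\nu_1,\ldots,\nu_q)=\sum_{1\le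 i_1<\cdots<i_p\le q}(\nu_1,\ldots,\nu_{i_1}+\mu_1,\ldots,\nu_{i_p}+\mu_p,\ldots,\nu_q);$$ $O_\phi=\mathrm{id}$; and $v\mapsto O_v$ is extended linearly to $v\in\tilde V$. For $r\ge1$, $u(r)$ is $u$ applied to the one-entry multi-index $(r)$; for $r=0$, $(r)=\phi$, so $u(0)=\phi$. Harmonic product: for multi-indices $\mu,\nu$, let $\mathcal{H}_{\mu,\nu}$ be the set of all $2\times l$ matrices $M=(m_{ij})$ ($l\ge1$ arbitrary) with non-negative integer entries such that deleting zeros from the first row gives $\mu$, deleting zeros from the second row gives $\nu$, and $m_{1j}+m_{2j}>0$ for all $j$. Put $\mu*\nu=\sum_{M\in\mathcal{H}_{\mu,\nu}}(m_{11}+m_{21},\ldots,m_{1l}+m_{2l})\in V$, extended bilinearly to $V\times V$. $V*V$ denotes the $\mathbb{Q}$-span of all $v*w$ with $v,w\in V$. *)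

(* Defs.v *)
From HB Require Import structures.
From mathcomp Require Import all_boot all_algebra.
From mathcomp Require Import freeg.

Set Implicit Arguments.
Unset Strict Implicit.
Unset Printing Implicit Defensive.

Import GRing.Theory.
Local Open Scope ring_scope.

Definition allpos (s : seq nat) : bool := all (leq 1) s.

(* The empty multi-index is included; it is excluded from V below. *)
Record mindex := Mindex { parts :> seq nat; _ : allpos parts }.

HB.instance Definition _ := [isSub for parts].
HB.instance Definition _ := [Choice of mindex by <:].

Definition del0 (s : seq nat) : seq nat := [seq k <- s | (0 < k)%N].

Fact del0_pos (s : seq nat) : allpos (del0 s).
Proof. exact: filter_all. Qed.

(* [mi s] deletes the zeros of [s]; this makes the constructor total, and it  *)
(* changes nothing when all entries of [s] are positive. In particular        *)
(* [mi [:: r]] is (r) if r > 0 and the empty multi-index if r = 0.            *)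
Definition mi (s : seq nat) : mindex := Mindex (del0_pos s).

Definition phi : mindex := mi [::].

Lemma miE (s : seq nat) : allpos s -> mi s = s :> seq nat.
Proof. by move=> /all_filterP. Qed.

Definition weight (mu : mindex) : nat := sumn mu.

(* The set S_m(mu) of proper partial sums, as an increasing sequence. *)
Definition psums (s : seq nat) : seq nat :=
  [seq sumn (take k s) | k <- iota 1 (size s).-1].
Definition cuts (mu : mindex) : seq nat := psums mu.

(* A composition of n.+2 is (1, c) or (c_1 + 1, c_2, ...) with c a            *)
(* composition of n.+1.                                                       *)
Fixpoint comps_seq (n : nat) : seq (seq nat) :=
  match n with
  | 0 => [:: [::]]
  | 1 => [:: [:: 1%N]]
  | n'.+1 => [seq 1%N :: c | c <- comps_seq n'] ++
             [seq incr_nth c 0 | c <- comps_seq n']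
  end.

Definition comps (n : nat) : seq mindex := [seq mi s | s <- comps_seq n].

Lemma comps_seqSS n : comps_seq n.+2 =
  [seq 1%N :: c | c <- comps_seq n.+1] ++
  [seq incr_nth c 0 | c <- comps_seq n.+1].
Proof. by []. Qed.

Lemma mem_comps_seq n s : (s \in comps_seq n) = allpos s && (sumn s == n).
Proof.
elim: n s => [|[|n] IH] s.
- by case: s => [|[|a] s] //=; rewrite inE /= andbF.
- rewrite inE; case: s => [|[|[|a]] s] //=; last by rewrite andbF.
  by case: s => [|[|b] s] //=; rewrite andbF.
rewrite comps_seqSS mem_cat; apply/orP/andP => [[]/mapP [c]|[s_pos s_sum]].
- by rewrite IH => /andP[c_pos /eqP c_sum] ->; split; rewrite //= c_sum.
- rewrite IH => /andP[c_pos /eqP c_sum] ->.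
  case: c c_pos c_sum => [|a c] //= /andP[a_pos c_pos] <-.
  by rewrite c_pos addSn eqxx.
case: s s_pos s_sum => [|[|[|a]] s] //= s_pos /eqP[s_sum]; [left|right].
- apply/mapP; exists s; rewrite // IH -s_sum add0n eqxx andbT.
  exact: s_pos.
- apply/mapP; exists (a.+1 :: s); rewrite // IH /=.
  by move: s_pos => /= ->; rewrite -s_sum addSn eqxx.
Qed.

Lemma mem_comps n mu : (mu \in comps n) = (weight mu == n).
Proof.
apply/mapP/idP => [[s]|mu_n].
  rewrite mem_comps_seq => /andP[s_pos /eqP <-] ->.
  by rewrite /weight miE.
exists (parts mu); first by rewrite mem_comps_seq (valP mu).
by apply: val_inj; rewrite [RHS]miE //; exact: (valP mu).
Qed.

Lemma uniq_comps n : uniq (comps n).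
Proof.
rewrite map_inj_in_uniq; last first.
  move=> s t; rewrite !mem_comps_seq => /andP[s_pos _] /andP[t_pos _].
  by move=> /(congr1 val); rewrite [LHS]miE // [RHS]miE.
elim: n => [|[|n] IH] //.
have inj_incr : {in comps_seq n.+1 &, injective (incr_nth ^~ 0)}.
  move=> s t; rewrite !mem_comps_seq.
  by case: s t => [|a s] [|b t] // _ _ [-> ->].
rewrite comps_seqSS cat_uniq map_inj_uniq; last by move=> s t [].
rewrite (map_inj_in_uniq inj_incr) IH andbT.
apply/hasPn => _ /mapP[s s_n ->]; apply/negP => /mapP[t _].
by move: s_n; rewrite mem_comps_seq; case: s => [|[|a] s].
Qed.

Definition dual_cuts (mu : mindex) : seq nat :=
  [seq k <- iota 1 (weight mu).-1 | k \notin cuts mu].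

(* The multi-index of the same weight whose set of partial sums is            *)
(* complementary; [cuts_dual] and [weight_dual] show that it is always found. *)
Definition dual (mu : mindex) : mindex :=
  head phi [seq nu <- comps (weight mu) | cuts nu == dual_cuts mu].

Lemma psums_cons a b s :
  psums (a :: b :: s) = a :: [seq (a + k)%N | k <- psums (b :: s)].
Proof.
rewrite /psums /= addn0 (iotaDl 1 1) -!map_comp; congr (_ :: _).
Qed.

Lemma psums_exists m s : (0 < m)%N -> sorted ltn s ->
  all (fun k => 0 < k < m)%N s ->
  exists c, [/\ allpos c, sumn c = m & psums c = s].
Proof.
elim/ltn_ind: m s => m IH [|a s] m_gt0.
  by exists [:: m]; split; rewrite //= ?addn0 // andbT.
move=> /= s_path /andP[/andP[a_gt0 a_lt_m] /allP s_lt].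
have a_lt_s : {in s, forall k, a < k}%N.
  by move=> k ks; exact: (allP (order_path_min ltn_trans s_path)) k ks.
have [||||c [c_pos c_sum c_cuts]] := IH (m - a)%N _ [seq (k - a)%N | k <- s].
- by rewrite ltn_subrL a_gt0.
- by rewrite subn_gt0.
- rewrite sorted_map;
  apply: (@sub_in_sorted _ (mem s) _ _ _ _ _ (path_sorted s_path)).
    move=> x y xs ys /= xy; rewrite ltn_sub2r //.
    exact: ltn_trans (a_lt_s x xs) xy.
  by apply/allP.
- apply/allP => _ /mapP[k ks ->]; rewrite subn_gt0.
  have /andP[_ km] := s_lt _ ks.
  by move: (a_lt_s _ ks) => /= ak; rewrite ak ltn_sub2r.
case: c c_pos c_sum c_cuts => [|b c] c_pos c_sum c_cuts.
  by move: a_lt_m; rewrite -subn_gt0 -c_sum.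
exists [:: a, b & c]; split.
- by rewrite /allpos /= a_gt0.
- by rewrite /= in c_sum *; rewrite c_sum subnKC // ltnW.
rewrite psums_cons c_cuts -map_comp; congr (_ :: _).
rewrite -[RHS]map_id; apply/eq_in_map => k ks /=.
by rewrite subnKC // ltnW //; exact: a_lt_s.
Qed.

Lemma dual_spec mu :
  (weight (dual mu) == weight mu) && (cuts (dual mu) == dual_cuts mu).
Proof.
suff [nu nu_w nu_c] : exists2 nu,
    weight nu = weight mu & cuts nu = dual_cuts mu.
  have: nu \in [seq x <- comps (weight mu) | cuts x == dual_cuts mu].
    by rewrite mem_filter nu_c eqxx mem_comps nu_w eqxx.
  rewrite /dual; case E: [seq _ <- _ | _] => [|x xs] // _.
  have: x \in [seq x <- comps (weight mu) | cuts x == dual_cuts mu].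
    by rewrite E mem_head.
  by rewrite mem_filter mem_comps /= andbC.
have [mu0|mu_gt0] := posnP (weight mu).
  exists phi; first by rewrite mu0.
  by rewrite /dual_cuts mu0.
have [||c [c_pos c_sum c_cuts]] := @psums_exists _ (dual_cuts mu) mu_gt0.
- by apply: sorted_filter; [exact: ltn_trans | exact: iota_ltn_sorted].
- apply/allP => k; rewrite mem_filter mem_iota => /andP[_].
  by rewrite add1n prednK.
by exists (Mindex c_pos).
Qed.

Lemma weight_dual mu : weight (dual mu) = weight mu.
Proof. by case/andP: (dual_spec mu) => /eqP. Qed.

Lemma cuts_dual mu : cuts (dual mu) = dual_cuts mu.
Proof. by case/andP: (dual_spec mu) => _ /eqP. Qed.

(* tilde V; the linear maps below are defined on all of it, and [inV] is the  *)
(* subspace V spanned by the nonempty multi-indices.                          *)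
Notation Vtilde := {freeg mindex / rat}.

Definition inV (v : Vtilde) : Prop := coeff phi v = 0.

Definition star (v : Vtilde) : Vtilde := fglift (fun mu => << dual mu >>) v.

Definition tau (v : Vtilde) : Vtilde :=
  fglift (fun mu : mindex => << mi (rev mu) >>) v.

Definition sigma (v : Vtilde) : Vtilde :=
  fglift (fun mu : mindex => << (-1) ^+ size mu *g mu >>) v.

Definition u_basis (mu : mindex) : Vtilde :=
  \sum_(nu <- comps (weight mu) | all (mem (cuts nu)) (cuts mu)) << nu >>.

Definition u (v : Vtilde) : Vtilde := fglift u_basis v.

(* The summation index [i] is a strictly increasing map from the positions of *)
(* [mu] to those of [nu], and at most one [k] has [i k = j]. If mu is empty   *)
(* there is one such map, and if only nu is empty there is none: see          *)
(* [O_basis_phi] and [O_basis_on_phi].                                        *)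
Definition O_basis (mu nu : mindex) : Vtilde :=
  \sum_(i : {ffun 'I_(size mu) -> 'I_(size nu)}
        | [forall a : 'I_(size mu), forall b : 'I_(size mu),
             (a < b)%N ==> (i a < i b)%N])
    << mi [seq (nth 0 nu (j : 'I_(size nu)) +
                \sum_(k < size mu | i k == j) nth 0 mu k)%N
          | j <- enum 'I_(size nu)] >>.

Definition O_op (v w : Vtilde) : Vtilde :=
  fglift (fun mu => fglift (O_basis mu) w) v.

Lemma O_basis_phi nu : O_basis phi nu = << nu >>.
Proof.
rewrite /O_basis (big_pred1 [ffun a : 'I_0 => False_rect _ (notF (ltn_ord a))]).
  congr << _ >>; apply: val_inj; rewrite /= -[RHS](all_filterP (valP nu)).
  congr del0; apply: (@eq_from_nth _ 0%N); rewrite size_map size_enum_ord //.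
  move=> j lt_j; rewrite (nth_map (Ordinal lt_j)) ?size_enum_ord //.
  by rewrite big_ord0 addn0 nth_enum_ord.
move=> i /=; transitivity true; first by apply/forallP => -[].
by apply/esym/eqP/ffunP => -[].
Qed.

Lemma O_basis_on_phi mu : mu != phi -> O_basis mu phi = 0.
Proof.
move=> mu_neq; apply: big1 => i _; case: (posnP (size mu)) => [|mu_gt0].
  by move=> /size0nil mu0; case/eqP: mu_neq; apply: val_inj.
by case: (i (Ordinal mu_gt0)).
Qed.

Definition row_seq (b l : nat) (M : 'M['I_b]_(2, l)) (i : 'I_2) : seq nat :=
  [seq (M i j : nat) | j <- enum 'I_l].

Definition col_sums (b l : nat) (M : 'M['I_b]_(2, l)) : seq nat :=
  [seq (M ord0 j + M ord_max j)%N | j <- enum 'I_l].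

Definition harmonic_mx (mu nu : mindex) (b l : nat) (M : 'M['I_b]_(2, l)) :=
  [&& del0 (row_seq M ord0) == mu, del0 (row_seq M ord_max) == nu
    & allpos (col_sums M)].

(* The bounds on l and on the entries only serve to make the sum finite:      *)
(* every column of a matrix in H_(mu, nu) has a nonzero entry, so             *)
(* l <= l(mu) + l(nu), and its nonzero entries are entries of mu or nu.       *)
Definition hprod_basis (mu nu : mindex) : Vtilde :=
  \sum_(1 <= l < (size mu + size nu).+1)
    \sum_(M : 'M['I_(weight mu + weight nu).+1]_(2, l) | harmonic_mx mu nu M)
      << mi (col_sums M) >>.

Definition hprod (v w : Vtilde) : Vtilde :=
  fglift (fun mu => fglift (hprod_basis mu) w) v.

Definition inVV (x : Vtilde) : Prop :=
  exists (n : nat) (c : 'I_n -> rat) (v w : 'I_n -> Vtilde),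
    (forall i, inV (v i) /\ inV (w i)) /\
    x = \sum_(i < n) c i *: hprod (v i) (w i).

(* Main.v *)
(* A composition is encoded as the word x^(k_1 - 1) y ... x^(k_p - 1) y. Up to  *)
(* the last letter, u is the substitution x -> x + y, y -> y, star exchanges x *)
(* and y, tau is reversal, and O_{u(r)} adds in all ways a total of r to the   *)
(* entries, i.e. inserts r letters x in front of the letters y. As u sigma is  *)
(* an involution, one has to show that u O_{u(r)} sigma (tau - star) maps V    *)
(* into V * V. Modulo V * V, two congruences are available:                    *)
(* - u star eps + u tau = 0 with eps(mu) = (-1)^|mu| mu: the antipode of the   *)
(*   quasi-shuffle Hopf algebra is -1 on indecomposables;                      *)
(* - u O_{u(r)} = (-1)^r u star O_{u(r)} star, because                         *)
(*   sum_i (-1)^i (1^i) * u O_{u(r-i)}(w) = (-1)^r u star O_{u(r)} star (w):   *)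
(*   both sides obey the same recursion on the letters of w.                   *)
(* Since O_{u(r)} commutes with sigma and tau, and sigma star = - star eps     *)
(* sigma, they combine to the claim.                                           *)

Require Import Defs.
From HB Require Import structures.
From mathcomp Require Import all_boot all_algebra.
From mathcomp Require Import freeg.

Set Implicit Arguments.
Unset Strict Implicit.
Unset Printing Implicit Defensive.

Import GRing.Theory.
Local Open Scope ring_scope.

(** * Operators on words *)

(** Let w = sigma(v) and eps = [wsign]. Since u sigma is an involution on V ([u_sigmaK]), it
    suffices to put u sigma O_{u(r)} (tau - star)(v) in V * V, and this element equals u O_{u(r)}
    tau(w) + u O_{u(r)} star(eps w). A nonempty multi-index is a word ending in y. The maps u, star,
    sigma, tau and O_{u(r)} all have recursions on the first letter, and identities between them are
    proved by induction on words. For instance, O_{u(r)} is the part of degree r in t of the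
    substitution that fixes x and sends y to y + t x y + t^2 x^2 y + ...

    First congruence. Multiplying a strict chain of summation indices by a weak one splits the
    product according to where the top index lies ([opH_coarsen_seq]). Modulo V * V this moves
    entries one by one, each with a sign, from the weak side to the strict side; at the end the word
    is reversed ([peak_mod], [antipode]). Applied to u(v), and rewritten with [coarsen_sigma_u] and
    [tau_u], this gives u star eps + u tau = 0 modulo V * V ([u_tau_mod]).

    Second congruence. Multiply the series of the u O_{u(r)}(v) t^r harmonically by the series of
    the (-t)^i (1^i). In degree r, all terms but the one with i = 0 lie in V * V, and the whole sum
    is computed by recursion on v to be (-1)^r u star O_{u(r)} star(v) ([conv_uO], [uO_mod]). *)

Section Fglift.
Variables (M : lmodType rat) (f : mindex -> M).

Lemma fglift_is_linear : linear (fglift f).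
Proof.
have faddB := @lift_is_additive rat mindex M f.
have fgl0 : fglift f 0 = 0 by rewrite -[X in fglift f X](subrr 0) faddB subrr.
have fglD : {morph fglift f : x y / x + y}.
  by move=> x y; rewrite -[y in LHS]opprK faddB -(sub0r y) faddB fgl0 sub0r opprK.
move=> a x y; rewrite fglD; congr (_ + _).
pose S (s : seq mindex) c := \sum_(z <- s) << c z *g z >> : Vtilde.
have fglS s c : fglift f (S s c) = \sum_(z <- s) c z *: f z.
  rewrite /S; elim: s => [|z s IH]; first by rewrite !big_nil fgl0.
  by rewrite !big_cons fglD IH liftU.
(* Scaling in the free group is by definition this sum over the domain of [x]. *)
have -> : a *: x = S (dom x) (fun z => a * coeff z x) by [].
rewrite -[in RHS](freeg_sumE x) !fglS scaler_sumr.
by apply: eq_bigr => z _; rewrite scalerA.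
Qed.

HB.instance Definition _ := @GRing.isLinear.Build rat Vtilde M _ (fglift f)
  fglift_is_linear.

Lemma fglift1 mu : fglift f << mu >> = f mu.
Proof. by rewrite liftU scale1r. Qed.

End Fglift.

HB.instance Definition _ := GRing.Linear.copy star (fglift (fun mu => << dual mu >>)).
HB.instance Definition _ := GRing.Linear.copy tau
  (fglift (fun mu : mindex => << mi (rev mu) >>)).
HB.instance Definition _ := GRing.Linear.copy sigma
  (fglift (fun mu : mindex => << (-1) ^+ size mu *g mu >>)).
HB.instance Definition _ := GRing.Linear.copy u (fglift u_basis).

Lemma freegU_scale (c : rat) (mu : mindex) : << c *g mu >> = c *: << mu >> :> Vtilde.
Proof. by apply/eqP/freeg_eqP => nu; rewrite coeffZ !coeffU mul1r. Qed.

(** Subspaces as predicates: this covers [inV] and [inVV] as well as any equation between linear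
    maps, so all of them can be checked on a basis. *)
Definition lin_closed (P : Vtilde -> Prop) :=
  P 0 /\ forall a v w, P v -> P w -> P (a *: v + w).

Lemma lin_closed_sum P (I : Type) (s : seq I) (Q : pred I) (F : I -> Vtilde) :
  lin_closed P -> (forall i, Q i -> P (F i)) -> P (\sum_(i <- s | Q i) F i).
Proof.
move=> [P0 PD] PF; elim/big_ind: _ => // x y Px Py.
by rewrite -[x]scale1r; apply: PD.
Qed.

Lemma Vtilde_ind P : lin_closed P -> (forall mu, P << mu >>) -> forall v, P v.
Proof.
move=> Pl Pb v; rewrite -[v]freeg_sumE; apply: lin_closed_sum => // mu _.
by case: Pl => P0 PD; rewrite freegU_scale -[_ *: _]addr0; apply: PD.
Qed.

Lemma inV_lin : lin_closed inV.
Proof.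
rewrite /lin_closed /inV; split=> [|a v w]; first by rewrite coeff0.
by rewrite coeffD coeffZ => -> ->; rewrite mulr0 addr0.
Qed.

Lemma inV_basis mu : mu != phi -> inV << mu >>.
Proof. by move=> mu0; rewrite /inV coeffU (negPf mu0) mulr0. Qed.

Lemma inV_ind0 P : lin_closed P -> (forall mu, mu != phi -> P << mu >>) ->
  forall v, inV v -> P v.
Proof.
move=> [P0 PD] Pb v vV; rewrite -[v]freeg_sumE big_seq.
apply: lin_closed_sum => // mu; have [->|mu0 _] := eqVneq mu phi.
  by rewrite mem_dom vV eqxx.
by rewrite freegU_scale -[_ *: _]addr0; apply: PD => //; apply: Pb.
Qed.

Definition inc_first (mu : mindex) : mindex := mi (incr_nth mu 0).
Definition inc_last (mu : mindex) : mindex := mi (incr_nth mu (size mu).-1).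

(* The letter y acts on the left by prepending an entry 1 and on the right by  *)
(* [opRY], the letter x by [opX] and [opRX], which kill the empty multi-index. *)
(* [prepend 0] is the identity, as [mi] deletes zeros.                         *)
Definition prepend (a : nat) : Vtilde -> Vtilde :=
  fglift (fun mu : mindex => << mi (a :: mu) >>).
Definition opX : Vtilde -> Vtilde :=
  fglift (fun mu => if mu == phi then 0 else << inc_first mu >>).
Definition opRY : Vtilde -> Vtilde := fglift (fun mu : mindex => << mi (rcons mu 1) >>).
Definition opRX : Vtilde -> Vtilde :=
  fglift (fun mu => if mu == phi then 0 else << inc_last mu >>).
Notation opY := (prepend 1).
Definition opZ v : Vtilde := opX v + opY v.
Definition wsign : Vtilde -> Vtilde :=
  fglift (fun mu : mindex => << (-1) ^+ weight mu *g mu >>).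

HB.instance Definition _ a := GRing.Linear.copy (prepend a)
  (fglift (fun mu : mindex => << mi (a :: mu) >>)).
HB.instance Definition _ := GRing.Linear.copy opX
  (fglift (fun mu => if mu == phi then 0 else << inc_first mu >>)).
HB.instance Definition _ := GRing.Linear.copy opRY
  (fglift (fun mu : mindex => << mi (rcons mu 1) >>)).
HB.instance Definition _ := GRing.Linear.copy opRX
  (fglift (fun mu => if mu == phi then 0 else << inc_last mu >>)).
HB.instance Definition _ := GRing.Linear.copy wsign
  (fglift (fun mu : mindex => << (-1) ^+ weight mu *g mu >>)).

Fact opZ_is_linear : linear opZ.
Proof. by move=> a v w; rewrite /opZ !linearP /= addrACA -scalerDr. Qed.
HB.instance Definition _ := @GRing.isLinear.Build rat Vtilde Vtilde _ opZ opZ_is_linear.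

Ltac by_linearity := let Hv := fresh in let Hw := fresh in
  split=> [|? ? ? Hv Hw];
  [by rewrite ?linear0 ?oppr0|by rewrite !linearP /= ?Hv ?Hw ?opprD ?scalerN].

Lemma mi_id (mu : mindex) : mi mu = mu.
Proof. by apply: val_inj; apply: (miE (valP mu)). Qed.

Lemma mi_cons a s : mi (a :: mi s) = mi (a :: s).
Proof. by apply: val_inj; rewrite /= /del0 /= filter_id. Qed.

Lemma mindex_eq (mu nu : mindex) : mu = nu :> seq nat -> mu = nu.
Proof. exact: val_inj. Qed.

Lemma mindexP (mu : mindex) : mu != phi ->
  exists a s, [/\ mu = a.+1 :: s :> seq nat, allpos s & mu = mi (a.+1 :: s)].
Proof.
case: mu => -[|[|a] s] //= mu_pos mu0; exists a, s; split=> //.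
by apply: mindex_eq; rewrite [RHS]miE.
Qed.

Lemma parts_mi a s : allpos s -> mi (a.+1 :: s) = a.+1 :: s :> seq nat.
Proof. by move=> s_pos; rewrite miE. Qed.

Lemma mi_neq0 a s : mi (a.+1 :: s) != phi.
Proof. by apply/eqP => /(congr1 (size \o parts)). Qed.

Lemma inc_firstE a s : inc_first (mi (a.+1 :: s)) = mi (a.+2 :: s).
Proof. by apply: val_inj; rewrite /= /del0 /= filter_id. Qed.

Lemma prepend_basis a (mu : mindex) : prepend a << mu >> = << mi (a :: mu) >>.
Proof. exact: fglift1. Qed.

Lemma prepend_mi a s : prepend a << mi s >> = << mi (a :: s) >>.
Proof. by rewrite prepend_basis mi_cons. Qed.

Lemma opX_mi a s : opX << mi (a.+1 :: s) >> = << mi (a.+2 :: s) >>.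
Proof. by rewrite /opX fglift1 (negPf (mi_neq0 a s)) inc_firstE. Qed.

Lemma opX_basis mu : mu != phi -> opX << mu >> = << inc_first mu >>.
Proof. by rewrite /opX fglift1 => /negPf ->. Qed.

Lemma opX_phi : opX << phi >> = 0.
Proof. by rewrite /opX fglift1 eqxx. Qed.

Lemma opX_prepend a v : opX (prepend a.+1 v) = prepend a.+2 v.
Proof.
elim/Vtilde_ind: v => [|mu]; first by_linearity.
by rewrite !prepend_basis opX_mi.
Qed.

(** Induction on the word, peeling off letters on the left until only the last y remains, which is
    the multi-index (1). *)
Lemma mindex_ind (P : mindex -> Prop) :
  P (mi [:: 1%N]) -> (forall mu, mu != phi -> P mu -> P (mi (1%N :: mu))) ->
  (forall mu, mu != phi -> P mu -> P (inc_first mu)) ->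
  forall mu, mu != phi -> P mu.
Proof.
move=> P1 PY PX mu mu0; have [a [s [_ s_pos ->]]] := mindexP mu0.
elim: s a {mu mu0} s_pos => [|b s IH] a.
  by move=> _; elim: a => // a IHa; rewrite -inc_firstE; apply: PX => //; apply: mi_neq0.
move=> /= /andP[]; case: b => // b _ s_pos; elim: a => [|a IHa].
  by rewrite -mi_cons; apply: PY; [apply: mi_neq0|apply: IH].
by rewrite -inc_firstE; apply: PX => //; apply: mi_neq0.
Qed.

(** The base case is the word y and not the empty word, because [star] exchanges the letters except
    the last one. *)
Lemma inV_ind P : lin_closed P -> P (opY << phi >>) ->
  (forall v, inV v -> P v -> P (opY v)) -> (forall v, inV v -> P v -> P (opX v)) ->
  forall v, inV v -> P v.
Proof.
move=> Pl P1 PY PX; apply: inV_ind0 => // mu; elim/mindex_ind => [|nu nu0|nu nu0].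
- by rewrite -prepend_mi.
- by rewrite -prepend_basis; apply: PY; apply: inV_basis.
- by rewrite -opX_basis //; apply: PX; apply: inV_basis.
Qed.

Lemma Vtilde_indXY P : lin_closed P -> P << phi >> ->
  (forall v, P v -> P (opY v)) -> (forall v, inV v -> P v -> P (opX v)) ->
  forall v, P v.
Proof.
move=> Pl P0 PY PX; apply: Vtilde_ind => // mu; have [->//|mu0] := eqVneq mu phi.
by apply: (@inV_ind P) (inV_basis mu0) => // [|v _]; apply: PY.
Qed.

Lemma inV_map P (f : {linear Vtilde -> Vtilde}) :
  lin_closed P -> lin_closed (fun v => P (f v)).
Proof.
move=> [P0 PD]; split=> [|a v w Pv Pw]; first by rewrite linear0.
by rewrite linearP; apply: PD.
Qed.

Lemma inV_prepend a v : inV (prepend a.+1 v).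
Proof.
elim/Vtilde_ind: v => [|mu]; first exact: (inV_map (prepend a.+1) inV_lin).
by rewrite prepend_basis; apply: inV_basis; apply: mi_neq0.
Qed.

Lemma inV_opX v : inV (opX v).
Proof.
elim/Vtilde_ind: v => [|mu]; first exact: (inV_map opX inV_lin).
have [->|mu0] := eqVneq mu phi; first by rewrite opX_phi; case: inV_lin.
have [a [s [_ _ ->]]] := mindexP mu0.
by rewrite opX_mi; apply: inV_basis; apply: mi_neq0.
Qed.

Lemma inVD v w : inV v -> inV w -> inV (v + w).
Proof. by move=> vV wV; rewrite -[v]scale1r; apply: inV_lin.2. Qed.

Lemma inVZ a v : inV v -> inV (a *: v).
Proof. by move=> vV; rewrite -[_ *: _]addr0; apply: inV_lin.2 => //; case: inV_lin. Qed.

Lemma inVN v : inV v -> inV (- v).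
Proof. by move=> vV; rewrite -scaleN1r; apply: inVZ. Qed.

Lemma inV_opZ v : inV (opZ v).
Proof. by apply: inVD; [apply: inV_opX|apply: inV_prepend]. Qed.

Lemma sigma_basis mu : sigma << mu >> = (-1) ^+ size mu *: << mu >>.
Proof. by rewrite /sigma fglift1 freegU_scale. Qed.

Lemma wsign_basis mu : wsign << mu >> = (-1) ^+ weight mu *: << mu >>.
Proof. by rewrite /wsign fglift1 freegU_scale. Qed.

Lemma sigma_opY v : sigma (opY v) = - opY (sigma v).
Proof.
elim/Vtilde_ind: v => [|mu]; first by_linearity.
rewrite prepend_basis !sigma_basis parts_mi ?(valP mu) // linearZ /= prepend_basis.
by rewrite exprS mulN1r scaleNr.
Qed.

Lemma sigma_opX v : sigma (opX v) = opX (sigma v).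
Proof.
elim/Vtilde_ind: v => [|mu]; first by_linearity.
have [->|mu0] := eqVneq mu phi.
  by rewrite sigma_basis linearZ /= opX_phi linear0 scaler0.
have [a [s [_ s_pos ->]]] := mindexP mu0.
by rewrite opX_mi !sigma_basis !parts_mi // linearZ /= opX_mi.
Qed.

Lemma wsign_opY v : wsign (opY v) = - opY (wsign v).
Proof.
elim/Vtilde_ind: v => [|mu]; first by_linearity.
rewrite prepend_basis !wsign_basis /weight parts_mi ?(valP mu) // linearZ /= prepend_basis.
by rewrite exprS mulN1r scaleNr.
Qed.

Lemma wsign_opX v : wsign (opX v) = - opX (wsign v).
Proof.
elim/Vtilde_ind: v => [|mu]; first by_linearity.
have [->|mu0] := eqVneq mu phi.
  by rewrite wsign_basis linearZ /= opX_phi linear0 scaler0 oppr0.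
have [a [s [_ s_pos ->]]] := mindexP mu0.
rewrite opX_mi !wsign_basis /weight !parts_mi // linearZ /= opX_mi.
by rewrite addSn exprS mulN1r scaleNr.
Qed.

Lemma sigma_phi : sigma << phi >> = << phi >>.
Proof. by rewrite sigma_basis scale1r. Qed.
Lemma wsign_phi : wsign << phi >> = << phi >>.
Proof. by rewrite wsign_basis scale1r. Qed.

(** * Recursions for u, star, sigma and tau *)

Lemma psums_inc a s : psums (a.+1 :: s) = map succn (psums (a :: s)).
Proof.
case: s => [|b s] //; rewrite !psums_cons /= -map_comp.
by congr (_ :: _); apply: eq_map => k /=; rewrite addSn.
Qed.

Lemma psums_cons1 s : s != [::] -> psums (1%N :: s) = 1%N :: map succn (psums s).
Proof. by case: s => // b s _; rewrite psums_cons. Qed.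

Lemma psums_inj s t : allpos s -> allpos t -> sumn s = sumn t ->
  psums s = psums t -> s = t.
Proof.
elim: s t => [|a s IH] [|c t] //=.
- move=> _ /andP[c_gt0 _] /esym/eqP; rewrite addn_eq0 => /andP[/eqP c0].
  by rewrite c0 in c_gt0.
- move=> /andP[a_gt0 _] _ /eqP; rewrite addn_eq0 => /andP[/eqP a0].
  by rewrite a0 in a_gt0.
case: s IH => [|b s] IH; case: t => [|d t].
- by move=> _ _; rewrite /= !addn0 => ->.
- by rewrite psums_cons.
- by rewrite psums_cons.
rewrite !psums_cons => /andP[_ s_pos] /andP[_ t_pos] sum_eq [ac].
rewrite ac in sum_eq *; move=> /inj_map st; congr (_ :: _); apply: IH => //.
  exact: addnI sum_eq.
by apply: st => x y; apply: addnI.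
Qed.

(** By injectivity of S_m; the recursions for [dual] then reduce to comparing weights and cut
    sets. *)
Lemma dual_uniq mu nu : weight nu = weight mu -> cuts nu = dual_cuts mu -> dual mu = nu.
Proof.
move=> nu_w nu_c; apply: val_inj; apply: psums_inj; rewrite ?(valP nu) ?(valP (dual mu)) //.
  by rewrite [LHS]weight_dual.
by rewrite [LHS]cuts_dual.
Qed.

Lemma weight_gt0 mu : mu != phi -> (0 < weight mu)%N.
Proof. by move=> /mindexP [a [s [_ s_pos ->]]]; rewrite /weight parts_mi. Qed.

Lemma dual_neq0 mu : mu != phi -> dual mu != phi.
Proof.
by move=> /weight_gt0; rewrite -weight_dual; apply: contraTneq => ->.
Qed.

Lemma iotaS n : iota 1 n.+1 = 1%N :: map succn (iota 1 n).
Proof. by rewrite [LHS]/= (iotaDl 1 1); congr (_ :: _); apply: eq_map. Qed.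

Lemma weight_cons (mu : mindex) : weight (mi (1%N :: mu)) = (weight mu).+1.
Proof. by rewrite /weight parts_mi ?(valP mu). Qed.

Lemma weight_inc mu : mu != phi -> weight (inc_first mu) = (weight mu).+1.
Proof.
by move=> /mindexP [a [s [_ s_pos ->]]]; rewrite inc_firstE /weight !parts_mi.
Qed.

Lemma cuts_cons (mu : mindex) :
  mu != phi -> cuts (mi (1%N :: mu)) = 1%N :: map succn (cuts mu).
Proof. by move=> mu0; rewrite /cuts parts_mi ?(valP mu) // psums_cons1. Qed.

Lemma cuts_inc mu : mu != phi -> cuts (inc_first mu) = map succn (cuts mu).
Proof.
by move=> /mindexP [a [s [_ s_pos ->]]]; rewrite inc_firstE /cuts !parts_mi // psums_inc.
Qed.

Lemma mem_map_succ s k : (k.+1 \in map succn s) = (k \in s).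
Proof. by rewrite mem_map //; apply: succn_inj. Qed.

Lemma not0_cuts mu : 0%N \notin cuts mu.
Proof.
have [->//|/mindexP [a [s [_ s_pos ->]]]] := eqVneq mu phi.
rewrite /cuts parts_mi // /psums; apply/mapP => -[k]; rewrite mem_iota.
by case: k.
Qed.

Lemma not1_map_cuts mu : (1%N \in map succn (cuts mu)) = false.
Proof. by rewrite mem_map_succ; apply: (negPf (not0_cuts mu)). Qed.

Lemma filter_succ (s t : seq nat) :
  [seq k <- map succn s | k \notin map succn t] = map succn [seq k <- s | k \notin t].
Proof.
by rewrite filter_map; congr map; apply: eq_filter => k /=; rewrite mem_map_succ.
Qed.

(** A leading entry 1 creates a cut at 1 and shifts the other cuts; the complement is shifted too
    and has no cut at 1. *)
Lemma dual_cons (mu : mindex) : mu != phi -> dual (mi (1%N :: mu)) = inc_first (dual mu).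
Proof.
move=> mu0; have d0 := dual_neq0 mu0; apply: dual_uniq.
  by rewrite weight_inc // weight_cons weight_dual.
rewrite cuts_inc // cuts_dual /dual_cuts cuts_cons // weight_cons /=.
case: (weight mu) (weight_gt0 mu0) => // n _; rewrite iotaS /=.
rewrite -filter_succ; apply: eq_in_filter => k /mapP [j].
by rewrite mem_iota inE => /andP[j_gt0 _] ->; case: j j_gt0.
Qed.

Lemma dual_inc mu : mu != phi -> dual (inc_first mu) = mi (1%N :: dual mu).
Proof.
move=> mu0; have d0 := dual_neq0 mu0; apply: dual_uniq.
  by rewrite weight_inc // weight_cons weight_dual.
rewrite cuts_cons // cuts_dual /dual_cuts cuts_inc // weight_inc //=.
case: (weight mu) (weight_gt0 mu0) => // n _; rewrite iotaS /=.
by rewrite not1_map_cuts /= filter_succ.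
Qed.

Lemma star_basis mu : star << mu >> = << dual mu >>.
Proof. exact: fglift1. Qed.

Lemma star_base : star (opY << phi >>) = opY << phi >>.
Proof. by rewrite prepend_mi star_basis (@dual_uniq _ (mi [:: 1%N])). Qed.

Lemma star_opY v : inV v -> star (opY v) = opX (star v).
Proof.
move: v; apply: inV_ind0 => [|mu mu0]; first by_linearity.
by rewrite prepend_basis !star_basis dual_cons // opX_basis // dual_neq0.
Qed.

Lemma star_opX v : inV v -> star (opX v) = opY (star v).
Proof.
move: v; apply: inV_ind0 => [|mu mu0]; first by_linearity.
by rewrite opX_basis // !star_basis dual_inc // prepend_basis.
Qed.

Lemma inV_star v : inV v -> inV (star v).
Proof.
move: v; apply: inV_ind0 => [|mu mu0]; first exact: (inV_map star inV_lin).
by rewrite star_basis; apply: inV_basis; apply: dual_neq0.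
Qed.

Lemma starK v : inV v -> star (star v) = v.
Proof.
move: v; apply: inV_ind => [||v vV IH|v vV IH]; first by_linearity.
- by rewrite !star_base.
- by rewrite star_opY // star_opX ?IH //; apply: inV_star.
- by rewrite star_opX // star_opY ?IH //; apply: inV_star.
Qed.

Lemma u_basisE mu : u << mu >> = u_basis mu.
Proof. exact: fglift1. Qed.

Lemma u_phi : u << phi >> = << phi >>.
Proof. by rewrite u_basisE /u_basis big_cons big_nil /= addr0. Qed.

Lemma u_base : u (opY << phi >>) = opY << phi >>.
Proof. by rewrite prepend_mi u_basisE /u_basis big_cons big_nil /= addr0. Qed.

Lemma compsSS n : comps n.+2 =
  [seq mi (1%N :: mu) | mu : mindex <- comps n.+1] ++ [seq inc_first mu | mu <- comps n.+1].
Proof.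
rewrite /comps comps_seqSS map_cat -!map_comp; congr (_ ++ _).
  by apply: eq_map => s /=; rewrite mi_cons.
apply/eq_in_map => s; rewrite mem_comps_seq => /andP[s_pos _] /=.
by rewrite /inc_first miE.
Qed.

Lemma comps_neq0 n mu : mu \in comps n.+1 -> mu != phi.
Proof. by rewrite mem_comps; apply: contraTneq => ->. Qed.

(** A refinement of (1, mu) must have a cut at 1, so it starts with y; for [inc_first mu] the cut at
    1 is optional, which gives x + y. *)
Lemma u_rec (mu : mindex) : mu != phi ->
  u << mi (1%N :: mu) >> = opY (u << mu >>) /\
  u << inc_first mu >> = opZ (u << mu >>).
Proof.
move=> mu0; rewrite !u_basisE /opZ /u_basis weight_cons weight_inc //.
rewrite cuts_cons // cuts_inc //; case: weight (weight_gt0 mu0) => // n _.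
rewrite !raddf_sum compsSS; have := @comps_neq0 n.
move: (comps n.+1) => s s_neq0; rewrite !big_cat !big_map /=.
split; last rewrite addrC.
  (* Compositions without a cut at 1 do not refine (1, mu). *)
  rewrite [X in _ + X]big1_seq ?addr0.
    rewrite [LHS]big_seq_cond [RHS]big_seq_cond; apply: eq_big => [nu|nu]; last first.
      by move=> _; rewrite prepend_basis.
    apply: andb_id2l => /s_neq0 nu0; rewrite cuts_cons // inE eqxx /= all_map.
    apply: eq_in_all => k k_mu /=; rewrite inE mem_map_succ; case: eqP => // -[k0].
    by move: (not0_cuts mu); rewrite -k0 k_mu.
  move=> nu /andP[/andP[nu_1 _] nu_n]; move: nu_1.
  by rewrite cuts_inc ?(s_neq0 _ nu_n) // not1_map_cuts.
congr (_ + _).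
  rewrite [LHS]big_seq_cond [RHS]big_seq_cond; apply: eq_big => [nu|nu].
    apply: andb_id2l => /s_neq0 nu0; rewrite cuts_inc // all_map.
    by apply: eq_all => k /=; rewrite mem_map_succ.
  by case/andP=> /s_neq0 nu0 _; rewrite opX_basis.
rewrite [LHS]big_seq_cond [RHS]big_seq_cond; apply: eq_big => [nu|nu].
  apply: andb_id2l => /s_neq0 nu0; rewrite cuts_cons // all_map.
  apply: eq_in_all => k k_mu /=; rewrite inE mem_map_succ; case: eqP => // -[k0].
  by move: (not0_cuts mu); rewrite -k0 k_mu.
by move=> _; rewrite prepend_basis.
Qed.

Lemma u_opY v : u (opY v) = opY (u v).
Proof.
elim/Vtilde_ind: v => [|mu]; first by_linearity.
have [->|mu0] := eqVneq mu phi; first by rewrite u_base u_phi.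
by rewrite prepend_basis; case: (u_rec mu0).
Qed.

Lemma u_opX v : inV v -> u (opX v) = opZ (u v).
Proof.
move: v; apply: inV_ind0 => [|mu mu0]; first by_linearity.
by rewrite opX_basis //; case: (u_rec mu0).
Qed.

Lemma inV_u v : inV v -> inV (u v).
Proof.
move: v; apply: inV_ind => [||v vV _|v vV _]; first exact: (inV_map u inV_lin).
- by rewrite u_base; apply: inV_prepend.
- by rewrite u_opY; apply: inV_prepend.
- by rewrite u_opX //; apply: inV_opZ.
Qed.

Lemma inV_sigma v : inV v -> inV (sigma v).
Proof.
move: v; apply: inV_ind0 => [|mu mu0]; first exact: (inV_map sigma inV_lin).
by rewrite sigma_basis; apply: inVZ; apply: inV_basis.
Qed.

Lemma inV_wsign v : inV v -> inV (wsign v).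
Proof.
move: v; apply: inV_ind0 => [|mu mu0]; first exact: (inV_map wsign inV_lin).
by rewrite wsign_basis; apply: inVZ; apply: inV_basis.
Qed.

(** * Reversal, and letters acting on the right *)

Lemma tau_basis (mu : mindex) : tau << mu >> = << mi (rev mu) >>.
Proof. exact: fglift1. Qed.

Lemma allpos_rev s : allpos (rev s) = allpos s.
Proof. exact: all_rev. Qed.

Lemma tauK v : tau (tau v) = v.
Proof.
elim/Vtilde_ind: v => [|mu]; first by_linearity.
by rewrite !tau_basis miE ?allpos_rev ?(valP mu) // revK mi_id.
Qed.

Lemma opRY_basis (mu : mindex) : opRY << mu >> = << mi (rcons mu 1) >>.
Proof. exact: fglift1. Qed.

Lemma opRX_phi : opRX << phi >> = 0.
Proof. by rewrite /opRX fglift1 eqxx. Qed.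

Lemma opRX_basis mu : mu != phi -> opRX << mu >> = << inc_last mu >>.
Proof. by rewrite /opRX fglift1 => /negPf ->. Qed.

Lemma rev_neq0 mu : mu != phi -> mi (rev mu) != phi.
Proof.
apply: contraNneq => /(congr1 parts); rewrite miE ?allpos_rev ?(valP mu) //.
by move=> /(congr1 size); rewrite size_rev => /size0nil mu0; apply/eqP/val_inj.
Qed.

Lemma incr_nth_last s a : incr_nth (rcons s a) (size s) = rcons s a.+1.
Proof. by elim: s => //= b s ->. Qed.

Lemma inc_last_rev mu : mu != phi -> inc_last (mi (rev mu)) = mi (rev (inc_first mu)).
Proof.
move=> /mindexP [a [s [_ s_pos ->]]]; rewrite inc_firstE !parts_mi //.
rewrite /inc_last miE ?allpos_rev // size_rev /= !rev_cons.
by rewrite -[size s]size_rev incr_nth_last.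
Qed.

Lemma tau_opY v : tau (opY v) = opRY (tau v).
Proof.
elim/Vtilde_ind: v => [|mu]; first by_linearity.
rewrite prepend_basis !tau_basis opRY_basis parts_mi ?(valP mu) // rev_cons.
by rewrite miE ?allpos_rev ?(valP mu).
Qed.

Lemma tau_opX v : tau (opX v) = opRX (tau v).
Proof.
elim/Vtilde_ind: v => [|mu]; first by_linearity.
have [->|mu0] := eqVneq mu phi.
  by rewrite opX_phi tau_basis opRX_phi linear0.
by rewrite opX_basis // !tau_basis opRX_basis ?rev_neq0 // inc_last_rev.
Qed.

Lemma tau_phi : tau << phi >> = << phi >>.
Proof. by rewrite tau_basis; congr << _ >>; apply: val_inj. Qed.

Lemma inV_tau v : inV v -> inV (tau v).
Proof.
move: v; apply: inV_ind0 => [|mu mu0]; first exact: (inV_map tau inV_lin).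
by rewrite tau_basis; apply: inV_basis; apply: rev_neq0.
Qed.

Lemma opRY_phi : opRY << phi >> = opY << phi >>.
Proof. by rewrite opRY_basis prepend_basis. Qed.

Lemma opRY_opY v : opRY (opY v) = opY (opRY v).
Proof.
elim/Vtilde_ind: v => [|mu]; first by_linearity.
by rewrite prepend_basis !opRY_basis prepend_mi parts_mi ?(valP mu).
Qed.

(** Left and right actions commute by associativity, but not on the empty word: [opX] kills [phi],
    whereas it sends [opRY] of [phi] to (2). *)
Lemma opRY_opX v : inV v -> opRY (opX v) = opX (opRY v).
Proof.
move: v; apply: inV_ind0 => [|mu mu0]; first by_linearity.
have [a [s [_ s_pos ->]]] := mindexP mu0.
by rewrite opX_mi !opRY_basis !parts_mi //= opX_mi.
Qed.

Lemma opRX_opY v : inV v -> opRX (opY v) = opY (opRX v).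
Proof.
move: v; apply: inV_ind0 => [|mu mu0]; first by_linearity.
have [a [s [_ s_pos ->]]] := mindexP mu0.
rewrite prepend_mi !opRX_basis ?mi_neq0 // prepend_basis /inc_last !parts_mi //=.
by rewrite mi_cons.
Qed.

Lemma opRX_opX v : inV v -> opRX (opX v) = opX (opRX v).
Proof.
move: v; apply: inV_ind0 => [|mu mu0]; first by_linearity.
have [a [s [_ s_pos ->]]] := mindexP mu0.
rewrite opX_mi !opRX_basis ?mi_neq0 // /inc_last !parts_mi //=.
by case: s {s_pos} => [|b s] /=; rewrite opX_mi.
Qed.

Lemma opRX_base : opRX (opY << phi >>) = opX (opY << phi >>).
Proof.
by rewrite prepend_mi opX_basis ?opRX_basis ?mi_neq0 // /inc_last /inc_first parts_mi.
Qed.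

Lemma inV_opRY v : inV (opRY v).
Proof. by rewrite -[v]tauK -tau_opY; apply: inV_tau; apply: inV_prepend. Qed.

Lemma inV_opRX v : inV v -> inV (opRX v).
Proof.
by move=> vV; rewrite -[v]tauK -tau_opX; apply: inV_tau; apply: inV_opX.
Qed.

Lemma u_opRY v : u (opRY v) = opRY (u v).
Proof.
elim/Vtilde_indXY: v => [||v IH|v vV IH]; first by_linearity.
- by rewrite opRY_phi u_phi u_base opRY_phi.
- by rewrite opRY_opY !u_opY IH opRY_opY.
have [RYV uV] := (inV_opRY v, inV_u vV).
by rewrite opRY_opX // !u_opX // IH /opZ linearD /= -opRY_opX // opRY_opY.
Qed.

Lemma u_opRX v : inV v -> u (opRX v) = opRX (u v) + opRY (u v).
Proof.
move: v; apply: inV_ind => [||v vV IH|v vV IH].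
- split=> [|a v w Hv Hw]; first by rewrite !linear0 addr0.
  by rewrite !linearP /= Hv Hw scalerDr addrACA.
- rewrite opRX_base u_opX ?u_base; last exact: inV_prepend.
  by rewrite opRX_base opRY_opY opRY_phi.
- have uV := inV_u vV.
  by rewrite opRX_opY // !u_opY IH opRX_opY // opRY_opY linearD.
have [RXV uV] := (inV_opRX vV, inV_u vV).
rewrite opRX_opX // !u_opX // IH /opZ !linearD /= opRX_opX // opRX_opY //.
by rewrite opRY_opX // opRY_opY addrACA.
Qed.

Lemma tau_u v : inV v -> tau (u v) = u (tau v).
Proof.
move: v; apply: inV_ind => [||v vV IH|v vV IH]; first by_linearity.
- by rewrite u_base tau_opY tau_phi opRY_phi u_base.
- by rewrite u_opY !tau_opY IH u_opRY.
have tV := inV_tau vV.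
by rewrite u_opX // !tau_opX u_opRX // /opZ linearD /= tau_opX tau_opY IH.
Qed.

(** * The operators O_{u(r)} *)

(** The increasing choices of [p] positions among [q], split by whether position 0 is chosen. They
    replace the functions of [O_basis] to make O recursive in the first entry. *)
Fixpoint incs (p q : nat) : seq (seq nat) :=
  match p, q with
  | 0, _ => [:: [::]]
  | _.+1, 0 => [::]
  | p'.+1, q'.+1 =>
      [seq 0%N :: map succn s | s <- incs p' q'] ++
      [seq map succn s | s <- incs p q']
  end.

Lemma incs0 q : incs 0 q = [:: [::]].
Proof. by case: q. Qed.

Lemma mem_incs p q s :
  (s \in incs p q) = [&& size s == p, sorted ltn s & all (gtn q) s].
Proof.
have sorted_succ t : sorted ltn (map succn t) = sorted ltn t.
  by rewrite sorted_map; apply: eq_sorted => x y /=.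
have all_succ n t : all (gtn n.+1) (map succn t) = all (gtn n) t by rewrite all_map.
have pos_succ t : all (ltn 0) t -> map succn (map predn t) = t.
  move=> /allP t_gt0; rewrite -map_comp -[RHS]map_id; apply/eq_in_map => k /t_gt0.
  by case: k.
have path0 t : path ltn 0 t = sorted ltn t && all (ltn 0) t.
  by rewrite (path_sortedE ltn_trans) andbC.
elim: q p s => [|q IH] [|p] s; try by case: s => [|x s] //=; rewrite ?andbF.
rewrite [incs _ _]/= mem_cat; apply/orP/and3P => [[]/mapP [t]|[]].
- rewrite IH => /and3P[/eqP t_p t_s t_q] ->.
  rewrite /= size_map t_p path0 sorted_succ t_s all_succ t_q all_map.
  by split=> //; apply/allP.
- by rewrite IH => /and3P[t_p t_s t_q] ->; rewrite size_map t_p sorted_succ t_s all_succ.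
case: s => [|[|x] s] // s_p.
  rewrite /= path0 => /andP[s_s /pos_succ s_E] s_q; left; apply/mapP.
  exists (map predn s); last by rewrite s_E.
  by rewrite IH size_map -eqSS s_p -sorted_succ -all_succ s_E s_s.
move=> s_s s_q; right; apply/mapP.
have s_E: x.+1 :: s = map succn (map predn (x.+1 :: s)).
  rewrite pos_succ //=.
  by apply: sub_all (order_path_min ltn_trans s_s) => y; apply: leq_ltn_trans.
exists (map predn (x.+1 :: s)) => //.
by rewrite IH -sorted_succ -all_succ -s_E s_s s_q size_map s_p.
Qed.

Lemma uniq_incs p q : uniq (incs p q).
Proof.
have inj_succ : injective (map succn) by apply: inj_map; apply: succn_inj.
elim: q p => [|q IH] [|p] //=.
rewrite cat_uniq !map_inj_uniq ?IH ?andbT //; last by move=> s t [/inj_succ].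
apply/hasPn => _ /mapP [[|x s] s_in ->]; first by rewrite mem_incs in s_in.
by apply/negP => /mapP [t _].
Qed.

Definition add_at (mu nu s : seq nat) : seq nat :=
  [seq (nth 0%N nu j + \sum_(k < size mu | nth 0%N s k == j) nth 0%N mu k)%N
  | j <- iota 0 (size nu)].

Definition O_seq (mu nu : seq nat) : Vtilde :=
  \sum_(s <- incs (size mu) (size nu)) << mi (add_at mu nu s) >>.

Lemma O_basisE mu nu : O_basis mu nu = O_seq mu nu.
Proof.
set p := size mu; set q := size nu.
pose g (i : {ffun 'I_p -> 'I_q}) := [seq val (i a) | a <- enum 'I_p].
have gE i (a : 'I_p) : nth 0%N (g i) a = i a.
  by rewrite (nth_map a) ?size_enum_ord // nth_ord_enum.
have g_sz i : size (g i) = p by rewrite size_map size_enum_ord.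
pose F s : Vtilde := << mi (add_at mu nu s) >>.
rewrite /O_basis (eq_bigr (F \o g)) => [|i _]; last first.
  congr << mi _ >>; rewrite /add_at -val_enum_ord -map_comp; apply: eq_map => j /=.
  congr (_ + _)%N; apply: eq_bigl => k; by rewrite gE.
rewrite -big_filter -(big_map g xpredT F); apply: perm_big; apply: uniq_perm.
- rewrite map_inj_uniq ?filter_uniq ?index_enum_uniq // => i j ij.
  by apply/ffunP => a; apply: ord_inj; rewrite -!gE ij.
- exact: uniq_incs.
move=> s; rewrite mem_incs; apply/mapP/and3P => [[i]|[/eqP s_p s_s /allP s_q]].
  rewrite mem_filter => /andP[/forallP i_mono _] ->; rewrite g_sz; split=> //.
    apply/(sortedP 0%N) => k; rewrite g_sz => lt_k.
    have /forallP/(_ (Ordinal lt_k)) := i_mono (Ordinal (ltnW lt_k)).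
    by rewrite /= ltnSn -!gE.
  by apply/allP => _ /mapP [a _ ->]; apply: (ltn_ord (i a)).
have lt_q (a : 'I_p) : (nth 0%N s a < q)%N by apply: s_q; rewrite mem_nth ?s_p.
exists [ffun a => Ordinal (lt_q a)].
  rewrite mem_filter mem_index_enum andbT; apply/forallP => a; apply/forallP => b.
  apply/implyP => ab; rewrite !ffunE /=.
  by apply: (sorted_ltn_nth ltn_trans 0%N s_s) => //; rewrite inE s_p.
apply: (@eq_from_nth _ 0%N); rewrite ?g_sz // => k; rewrite s_p => lt_k.
by rewrite (gE _ (Ordinal lt_k)) ffunE.
Qed.

Lemma add_at_cons a mu b nu s : size s = size mu ->
  add_at (a :: mu) (b :: nu) (0%N :: map succn s) = (b + a)%N :: add_at mu nu s.
Proof.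
move=> s_sz; rewrite /add_at /= (iotaDl 1 0) -map_comp; congr (_ :: _).
  rewrite big_mkcond big_ord_recl /= big1 ?addn0 // => k _.
  by rewrite /= add0n (nth_map 0%N) ?s_sz.
apply: eq_map => j /=; congr (_ + _)%N.
rewrite big_mkcond big_ord_recl /= add0n [RHS]big_mkcond.
by apply: eq_bigr => k _; rewrite /= add0n (nth_map 0%N) ?s_sz // add1n eqSS.
Qed.

Lemma add_at_skip mu b nu s : size s = size mu ->
  add_at mu (b :: nu) (map succn s) = b :: add_at mu nu s.
Proof.
move=> s_sz; rewrite /add_at /= (iotaDl 1 0) -map_comp; congr (_ :: _).
  rewrite big_mkcond big1 ?addn0 // => k _.
  by rewrite /= (nth_map 0%N) ?s_sz.
apply: eq_map => j /=; congr (_ + _)%N.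
rewrite big_mkcond [RHS]big_mkcond.
by apply: eq_bigr => k _; rewrite /= (nth_map 0%N) ?s_sz // add1n eqSS.
Qed.

(* The part of O_mu (b :: nu) in which the first entry of mu is added to b. *)
Definition O_head (mu nu : seq nat) b : Vtilde :=
  if mu is a :: mu' then prepend (b + a) (O_seq mu' nu) else 0.

Lemma size_incs p q s : s \in incs p q -> size s = p.
Proof. by rewrite mem_incs => /andP[/eqP]. Qed.

Lemma O_seq_cons mu b nu :
  O_seq mu (b :: nu) = O_head mu nu b + prepend b (O_seq mu nu).
Proof.
rewrite /O_head /O_seq linear_sum; case: mu => [|a mu] /=.
  by rewrite incs0 !big_seq1 add0r prepend_mi -add_at_skip.
rewrite big_cat !big_map linear_sum /=; congr (_ + _); apply: eq_big_seq => s s_in.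
  by rewrite prepend_mi add_at_cons // (size_incs s_in).
by rewrite prepend_mi add_at_skip // (size_incs s_in).
Qed.

Definition opO r : Vtilde -> Vtilde := O_op (u << mi [:: r] >>).

(** The multi-index (r) has no cuts, so every composition of r refines it. *)
Lemma u_row r : u << mi [:: r] >> = \sum_(mu <- comps r) << mu >>.
Proof.
rewrite u_basisE /u_basis; have -> : weight (mi [:: r]) = r.
  by case: r => [|r] //; rewrite /weight parts_mi //= addn0.
by case: r.
Qed.

Lemma opO_sum r v : opO r v = \sum_(mu <- comps r) fglift (O_basis mu) v.
Proof.
rewrite /opO /O_op u_row linear_sum; apply: eq_bigr => mu _; exact: fglift1.
Qed.

Fact opO_is_linear r : linear (opO r).
Proof.
move=> a v w; rewrite !opO_sum scaler_sumr -big_split.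
by apply: eq_bigr => mu _; rewrite linearP.
Qed.
HB.instance Definition _ r :=
  @GRing.isLinear.Build rat Vtilde Vtilde _ (opO r) (opO_is_linear r).

Lemma opO_basis r (nu : mindex) : opO r << nu >> = \sum_(mu <- comps r) O_seq mu nu.
Proof. by rewrite opO_sum; apply: eq_bigr => mu _; rewrite fglift1 O_basisE. Qed.

Lemma opO0 v : opO 0 v = v.
Proof.
elim/Vtilde_ind: v => [|nu]; first by_linearity.
by rewrite opO_sum big_seq1 fglift1; apply: O_basis_phi.
Qed.

Lemma opO_phi r : opO r.+1 << phi >> = 0.
Proof.
rewrite opO_sum big1_seq // => mu /comps_neq0 mu0.
by rewrite fglift1 O_basis_on_phi.
Qed.

Lemma opX_O_head mu nu b : opX (O_head mu nu b.+1) = O_head mu nu b.+2.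
Proof. by case: mu => [|a mu] /=; rewrite ?linear0 // opX_prepend. Qed.

Lemma opO_opX r v : opO r (opX v) = opX (opO r v).
Proof.
elim/Vtilde_ind: v => [|nu]; first by_linearity.
have [->|nu0] := eqVneq nu phi.
  rewrite opX_phi linear0; case: r => [|r]; first by rewrite opO0 opX_phi.
  by rewrite opO_phi linear0.
have [a [s [_ s_pos ->]]] := mindexP nu0.
rewrite opX_mi !opO_basis linear_sum; apply: eq_bigr => mu _.
by rewrite !parts_mi // !O_seq_cons linearD /= opX_O_head opX_prepend.
Qed.

(** O_{u(r)} distributes a total of r over the entries in all ways. Either the leading entry 1
    receives nothing, or one unit of what it receives is split off as a letter x. *)
Lemma opO_opY r v : opO r.+1 (opY v) = opY (opO r.+1 v) + opX (opO r (opY v)).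
Proof.
elim/Vtilde_ind: v => [|nu].
  split=> [|a v w Hv Hw]; first by rewrite !linear0 addr0.
  by rewrite !linearP /= Hv Hw scalerDr addrACA.
rewrite addrC prepend_basis !opO_basis parts_mi ?(valP nu) //.
rewrite [X in _ = _ + X]linear_sum /=; under eq_bigr do rewrite O_seq_cons.
rewrite big_split /=; congr (_ + _).
rewrite linear_sum /=; under [RHS]eq_bigr do rewrite O_seq_cons.
case: r => [|r].
  rewrite !big_seq1 parts_mi //= /O_seq incs0 /= !big_seq1 add0r.
  by rewrite -opX_prepend.
(* If the leading entry receives exactly 1, then after splitting off that unit it receives nothing;
   if it receives more, the first entry of the composition drops by one. *)
rewrite compsSS; have := @comps_neq0 r; move: (comps r.+1) => s s_neq0.
rewrite big_cat !big_map /= addrC -big_split /=; apply: eq_big_seq => mu /s_neq0 mu0.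
rewrite linearD /= -[del0 mu]/(parts (mi mu)) mi_id opX_prepend; congr (_ + _).
rewrite -[del0 _]/(parts (inc_first mu)); have [a [t [_ t_pos ->]]] := mindexP mu0.
by rewrite inc_firstE !parts_mi //= opX_prepend.
Qed.

Lemma inV_opO r v : inV v -> inV (opO r v).
Proof.
case: r => [|r]; first by rewrite opO0.
move: v; apply: inV_ind => [||v vV _|v vV _]; first exact: (inV_map (opO r.+1) inV_lin).
- by rewrite opO_opY opO_phi linear0 add0r; apply: inV_opX.
- by rewrite opO_opY; apply: inVD; [apply: inV_prepend|apply: inV_opX].
- by rewrite opO_opX; apply: inV_opX.
Qed.

Lemma opO_sigma r v : opO r (sigma v) = sigma (opO r v).
Proof.
elim: r v => [|r IH] v; first by rewrite !opO0.
elim/Vtilde_indXY: v => [||v Hv|v vV Hv]; first by_linearity.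
- by rewrite sigma_phi opO_phi linear0.
- rewrite sigma_opY linearN /= !opO_opY [in RHS]linearD /= sigma_opY sigma_opX Hv -IH.
  by rewrite sigma_opY !linearN /= opprD.
- by rewrite sigma_opX !opO_opX sigma_opX Hv.
Qed.

(** O_{u(r)} raises the weight by r. *)
Lemma opO_wsign r v : wsign (opO r v) = (-1) ^+ r *: opO r (wsign v).
Proof.
elim: r v => [|r IH] v; first by rewrite !opO0 scale1r.
elim/Vtilde_indXY: v => [||v Hv|v vV Hv].
- split=> [|a v w Hv Hw]; first by rewrite !linear0.
  by rewrite !linearP /= Hv Hw.
- by rewrite wsign_phi opO_phi !linear0.
- rewrite opO_opY [LHS]linearD /= wsign_opY wsign_opX Hv IH wsign_opY.
  rewrite [opO r (- _)]linearN [opO r.+1 (- _)]linearN /= !scalerN.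
  rewrite [opY (_ *: _)]linearZ [opX (- _)]linearN /= [opX (_ *: _)]linearZ /= opprK.
  by rewrite opO_opY scalerDr exprS mulN1r !scaleNr opprD !opprK.
- rewrite opO_opX !wsign_opX Hv [opO r.+1 (- _)]linearN [opX (_ *: _)]linearZ /=.
  by rewrite opO_opX scalerN.
Qed.

Lemma opO_opRX r v : inV v -> opO r (opRX v) = opRX (opO r v).
Proof.
elim: r v => [|r IH] v vV; first by rewrite !opO0.
move: v vV; apply: inV_ind => [||v vV Hv|v vV Hv]; first by_linearity.
- have YV : inV (opY << phi >>) by apply: inV_prepend.
  have OYV := inV_opO r YV.
  rewrite opRX_base opO_opX !opO_opY opO_phi !linear0 !add0r.
  by rewrite opRX_opX // -IH // opRX_base opO_opX.
- have [OV YV] := (inV_opO r.+1 vV, inV_prepend 0 v); have OYV := inV_opO r YV.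
  rewrite opRX_opY // !opO_opY Hv [in RHS]linearD /= opRX_opY // opRX_opX //.
  by rewrite -IH // opRX_opY.
- have [OV XV] := (inV_opO r.+1 vV, inV_opX v).
  by rewrite opRX_opX // !opO_opX opRX_opX // Hv.
Qed.

Lemma opO_opRY r v : opO r.+1 (opRY v) = opRY (opO r.+1 v) + opRX (opO r (opRY v)).
Proof.
elim: r v => [|r IHr] v; elim/Vtilde_indXY: v => [||v Hv|v vV Hv].
- split=> [|a v w Hv Hw]; first by rewrite !linear0 addr0.
  by rewrite !linearP /= Hv Hw scalerDr addrACA.
- by rewrite opRY_phi opO_opY !opO_phi !linear0 !add0r !opO0 opRX_base.
- have [RV YV] := (inV_opRY v, inV_prepend 0 v).
  rewrite opRY_opY !opO_opY Hv !linearD /= !opO0 opRY_opY -addrA [in RHS]addrAC -addrA.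
  by rewrite opRX_opY // [in RHS]addrC opRY_opX // opRY_opY addrC.
- have [RV OV] := (inV_opRY v, inV_opO 1 vV).
  rewrite opRY_opX // !opO_opX Hv linearD /= opO0 opRY_opX //.
  by rewrite opRX_opX // opO0.
- split=> [|a v w Hv Hw]; first by rewrite !linear0 addr0.
  by rewrite !linearP /= Hv Hw scalerDr addrACA.
- have YV : inV (opY << phi >>) by apply: inV_prepend.
  rewrite opRY_phi opO_opY !opO_phi !linear0 !add0r -opO_opRX //.
  by rewrite opRX_base opO_opX.
- have [RV YV] := (inV_opRY v, inV_prepend 0 v).
  have [OYV ORV] := (inV_opO r.+1 YV, inV_opO r.+1 RV).
  have OYR : inV (opO r (opY (opRY v))) by apply: inV_opO; apply: inV_prepend.
  rewrite opRY_opY opO_opY -opRY_opY [in LHS]IHr Hv opRY_opY.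
  rewrite [opO r.+2 (opY v)]opO_opY [opO r.+1 (opY (opRY v))]opO_opY !linearD /=.
  rewrite opRY_opY opRY_opX // opRX_opY // opRX_opX //.
  by rewrite addrACA.
- have [RV OV] := (inV_opRY v, inV_opO r.+2 vV); have ORV := inV_opO r.+1 RV.
  rewrite opRY_opX // !opO_opX Hv linearD /= opRY_opX //.
  by rewrite opRX_opX.
Qed.

(** Distributing r over the entries is symmetric under reversal: [opO_opRX] and [opO_opRY] mirror
    the recursions on the left. *)
Lemma opO_tau r v : opO r (tau v) = tau (opO r v).
Proof.
elim: r v => [|r IH] v; first by rewrite !opO0.
elim/Vtilde_indXY: v => [||v Hv|v vV Hv]; first by_linearity.
- by rewrite tau_phi opO_phi linear0.
- by rewrite tau_opY opO_opRY opO_opY linearD /= tau_opY tau_opX Hv -IH tau_opY.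
- have tV := inV_tau vV.
  by rewrite tau_opX opO_opRX // opO_opX tau_opX Hv.
Qed.

(** * The harmonic product *)

Ltac eq_cases :=
  repeat match goal with |- context [?x == ?y] => case: (x == y) end;
  repeat match goal with |- context [all ?p ?s] => case: (all p s) end.

(** The matrices of H as lists of columns, enumerated by their first column; this yields the
    quasi-shuffle recursion. The nested [fix] allows either argument to decrease. *)
Fixpoint stuffle (s : seq nat) : seq nat -> seq (seq (nat * nat)) :=
  fix stuffle_s t :=
  match s, t with
  | [::], [::] => [:: [::]]
  | [::], b :: t' => map (cons (0%N, b)) (stuffle_s t')
  | a :: s', [::] => map (cons (a, 0%N)) (stuffle s' [::])
  | a :: s', b :: t' =>
      map (cons (a, 0%N)) (stuffle s' t) ++
      map (cons (0%N, b)) (stuffle_s t') ++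
      map (cons (a, b)) (stuffle s' t')
  end.

Lemma stuffle_nil_cons b t :
  stuffle [::] (b :: t) = map (cons (0%N, b)) (stuffle [::] t).
Proof. by []. Qed.

Lemma stuffle_cons_nil a s :
  stuffle (a :: s) [::] = map (cons (a, 0%N)) (stuffle s [::]).
Proof. by []. Qed.

Lemma stuffle_cons a s b t : stuffle (a :: s) (b :: t) =
  map (cons (a, 0%N)) (stuffle s (b :: t)) ++
  map (cons (0%N, b)) (stuffle (a :: s) t) ++
  map (cons (a, b)) (stuffle s t).
Proof. by []. Qed.

Definition stuffleE := (stuffle_nil_cons, stuffle_cons_nil, stuffle_cons).

Definition harmonic_cols (s t : seq nat) (c : seq (nat * nat)) :=
  [&& del0 (unzip1 c) == s, del0 (unzip2 c) == t & all (fun p => 0 < p.1 + p.2)%N c].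

Lemma mem_map_cons (T : eqType) (x y : T) c L :
  (x :: c \in map (cons y) L) = (x == y) && (c \in L).
Proof.
apply/mapP/andP => [[d d_L [-> ->]]//|[/eqP-> c_L]]; by exists c.
Qed.

Lemma nil_map_cons (T : eqType) (y : T) L : ([::] \in map (cons y) L) = false.
Proof. by apply/mapP => -[]. Qed.

Lemma mem_stuffle s t c : allpos s -> allpos t ->
  (c \in stuffle s t) = harmonic_cols s t c.
Proof.
have zs (k : nat) : ((0%N == k.+1) = false) * ((k.+1 == 0%N) = false) by [].
elim: c s t => [|[x y] c IH] [|a s] [|b t]; rewrite ?stuffleE ?mem_cat ?nil_map_cons //.
- by rewrite /harmonic_cols /=; case: x y => [|x] [|y]; rewrite /= ?andbF.
- case: b => [|b] // _ t_pos; rewrite mem_map_cons IH // /harmonic_cols /del0 xpair_eqE.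
  by case: x y => [|x] [|y] //=; rewrite ?eqseq_cons ?eqxx ?zs ?andbF //; eq_cases.
- case: a => [|a] // s_pos _; rewrite mem_map_cons IH // /harmonic_cols /del0 xpair_eqE.
  by case: x y => [|x] [|y] //=; rewrite ?eqseq_cons ?eqxx ?zs ?andbF //; eq_cases.
case: a b => [|a] [|b] // s_pos t_pos.
rewrite !mem_map_cons !IH // /harmonic_cols /del0 !xpair_eqE.
by case: x y => [|x] [|y] //=; rewrite ?eqseq_cons ?eqxx ?zs ?andbF //; eq_cases.
Qed.

Lemma uniq_stuffle s t : allpos s -> allpos t -> uniq (stuffle s t).
Proof.
have inj_cons (x : nat * nat) : injective (cons x) by move=> c d [].
elim: s t => [|a s IHs] t.
  elim: t => // b t IHt _ /andP[_ t_pos].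
  by rewrite stuffleE map_inj_uniq //; apply: IHt.
case: a => [|a] // ; elim: t => [|b t IHt] s_pos.
  by move=> _; rewrite stuffleE map_inj_uniq //; apply: IHs.
case: b IHt => [|b] // IHt t_pos; rewrite stuffleE !cat_uniq !map_inj_uniq //.
rewrite IHs // IHs // (IHt s_pos) //= !andbT.
apply/andP; split; apply/hasPn => [[|[x y] c]]; rewrite ?mem_cat ?nil_map_cons //.
  rewrite !mem_map_cons !xpair_eqE; case: x y => [|x] [|y] //=; rewrite ?andbF //.
by rewrite !mem_map_cons !xpair_eqE; case: x y => [|x] [|y] //=; rewrite ?andbF.
Qed.

Definition csum (c : seq (nat * nat)) : seq nat := [seq (p.1 + p.2)%N | p <- c].

Definition harm (s t : seq nat) : Vtilde := \sum_(c <- stuffle s t) << mi (csum c) >>.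

Lemma harm_nill t : harm [::] t = << mi t >>.
Proof.
elim: t => [|b t IH]; first by rewrite /harm big_seq1.
rewrite -prepend_mi -IH /harm linear_sum stuffleE big_map /=; apply: eq_bigr => c _.
by rewrite prepend_mi.
Qed.

Lemma harm_nilr s : harm s [::] = << mi s >>.
Proof.
elim: s => [|a s IH]; first by rewrite /harm big_seq1.
rewrite -prepend_mi -IH /harm linear_sum stuffleE big_map /=; apply: eq_bigr => c _.
by rewrite prepend_mi addn0.
Qed.

Lemma harm_cons a s b t :
  harm (a :: s) (b :: t) =
    prepend a (harm s (b :: t)) + prepend b (harm (a :: s) t)
    + prepend (a + b)%N (harm s t).
Proof.
rewrite /harm stuffle_cons !big_cat !big_map !linear_sum /= addrA.
congr (_ + _ + _); apply: eq_bigr => c _; rewrite prepend_mi //=.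
by rewrite addn0.
Qed.

Lemma sumn_del0 s : sumn (del0 s) = sumn s.
Proof. by elim: s => //= -[|a] s /= ->. Qed.

Lemma leq_sumn x s : x \in s -> (x <= sumn s)%N.
Proof.
elim: s => //= y s IH; rewrite inE => /predU1P[->|/IH]; first exact: leq_addr.
by move=> xs; apply: leq_trans xs (leq_addl _ _).
Qed.

Lemma size_harmonic_cols s t c : harmonic_cols s t c -> (size c <= size s + size t)%N.
Proof.
rewrite /harmonic_cols => /and3P[/eqP <- /eqP <-].
elim: c => //= -[[|x] [|y]] c IH //= /IH le_c; rewrite ?addSn ?addnS ltnS //.
by rewrite leqW.
Qed.

(** Bounded matrices correspond to their column lists, level by level in l. A nonempty [mu] rules
    out the empty list of columns, which has no counterpart in a sum starting at l = 1. *)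
Lemma hprod_basisE (mu nu : mindex) : mu != phi -> hprod_basis mu nu = harm mu nu.
Proof.
move=> mu0; set b := (weight mu + weight nu)%N.
have [mu_pos nu_pos] := (valP mu : allpos mu, valP nu : allpos nu).
pose cols l (M : 'M['I_b.+1]_(2, l)) : seq (nat * nat) :=
  [seq (M ord0 j : nat, M ord_max j : nat) | j <- enum 'I_l].
pose F c : Vtilde := << mi (csum c) >>.
have size_cols l (M : 'M['I_b.+1]_(2, l)) : size (cols l M) = l.
  by rewrite size_map size_enum_ord.
have hcols l (M : 'M['I_b.+1]_(2, l)) :
    harmonic_mx mu nu M = harmonic_cols mu nu (cols l M).
  rewrite /harmonic_mx /harmonic_cols /unzip1 /unzip2 -[map fst _]map_comp.
  rewrite -[map snd _]map_comp; congr [&& _, _ & _].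
  by rewrite /allpos /col_sums all_map [RHS]all_map.
have nth_cols l (M : 'M['I_b.+1]_(2, l)) j :
    nth (0%N, 0%N) (cols l M) (j : 'I_l) = (M ord0 j : nat, M ord_max j : nat).
  by rewrite (nth_map j) ?size_enum_ord // nth_ord_enum.
have inj_cols l : injective (cols l).
  move=> M N MN; apply/matrixP => i j; apply: val_inj.
  have: nth (0%N, 0%N) (cols l M) j = nth (0%N, 0%N) (cols l N) j by rewrite MN.
  rewrite !nth_cols => -[M0 M1].
  have [->//|->//] : i = ord0 \/ i = ord_max.
  by case: i => -[|[|i]] // lt_i; [left|right]; apply: val_inj.
have level l : \sum_(M : 'M['I_b.+1]_(2, l) | harmonic_mx mu nu M)
      << mi (col_sums M) >> = \sum_(c <- stuffle mu nu | size c == l) F c.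
  rewrite (eq_bigr (F \o cols l)) => [|M _]; last first.
    by rewrite /F /csum /= -[map _ (cols l M)]map_comp.
  rewrite -big_filter -(big_map (cols l) xpredT F) -[RHS]big_filter.
  apply: perm_big; apply: uniq_perm.
  - by rewrite (map_inj_uniq (@inj_cols l)) filter_uniq // index_enum_uniq.
  - by rewrite filter_uniq // uniq_stuffle.
  move=> c; rewrite mem_filter mem_stuffle //; apply/mapP/andP => [[M]|[/eqP c_l c_h]].
    by rewrite mem_filter hcols => /andP[? _] ->; rewrite size_cols.
  pose m (i : 'I_2) (j : 'I_l) :=
    if i == ord0 then (nth (0%N, 0%N) c j).1 else (nth (0%N, 0%N) c j).2.
  pose M : 'M['I_b.+1]_(2, l) := \matrix_(i, j) inord (m i j).
  have le_m i j : (m i j <= b)%N.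
    have lt_j : (j < size c)%N by rewrite c_l.
    have /and3P[/eqP c1 /eqP c2 _] := c_h; rewrite /m /b.
    case: eqP => _; [apply: leq_trans (leq_addr _ _)|apply: leq_trans (leq_addl _ _)].
      by rewrite /weight -c1 sumn_del0 leq_sumn // map_f ?mem_nth.
    by rewrite /weight -c2 sumn_del0 leq_sumn // map_f ?mem_nth.
  have colsM : cols l M = c.
    apply: (@eq_from_nth _ (0%N, 0%N)); rewrite size_cols // => j lt_j.
    rewrite (nth_cols _ _ (Ordinal lt_j)).
    by rewrite !mxE !inordK ?ltnS //= -surjective_pairing.
  by exists M => //; rewrite mem_filter hcols colsM c_h mem_index_enum.
rewrite /hprod_basis (eq_bigr _ (fun l _ => level l)).
under eq_bigr do rewrite big_mkcond; rewrite exchange_big /=.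
rewrite [LHS]big_seq [RHS]big_seq; apply: eq_bigr => c; rewrite mem_stuffle // => c_h.
have c_gt0 : (0 < size c)%N.
  case: c c_h => // /and3P[/eqP /= c_mu _ _]; case/eqP: mu0; exact: val_inj.
(* Each column list occurs at exactly one level, its length, and this level is within the range of
   summation. *)
rewrite (bigD1_seq (size c)) ?iota_uniq ?mem_index_iota //=; last first.
  by rewrite c_gt0 ltnS; apply: size_harmonic_cols.
by rewrite eqxx big1 ?addr0 // => l; rewrite eq_sym => /negPf ->.
Qed.

(** * The antipode modulo products *)

Lemma inVV_lin : lin_closed inVV.
Proof.
split.
  exists 0%N, (fun=> 0), (fun=> 0), (fun=> 0); rewrite big_ord0.
  by split=> // -[].
move=> a _ _ [n1 [c1 [v1 [w1 [V1 ->]]]]] [n2 [c2 [v2 [w2 [V2 ->]]]]].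
pose sel (T : Type) (f : 'I_n1 -> T) (g : 'I_n2 -> T) i :=
  match split i with inl j => f j | inr j => g j end.
have selL T f g j : @sel T f g (lshift n2 j) = f j by rewrite /sel (unsplitK (inl j)).
have selR T f g j : @sel T f g (rshift n1 j) = g j by rewrite /sel (unsplitK (inr j)).
exists (n1 + n2)%N, (sel _ (fun j => a * c1 j) c2), (sel _ v1 v2), (sel _ w1 w2).
split=> [i|]; first by rewrite /sel; case: split => j.
rewrite big_split_ord /= scaler_sumr; congr (_ + _); apply: eq_bigr => j _.
  by rewrite !selL scalerA.
by rewrite !selR.
Qed.

Lemma inVVD v w : inVV v -> inVV w -> inVV (v + w).
Proof. by move=> vV wV; rewrite -[v]scale1r; apply: inVV_lin.2. Qed.

Lemma inVVZ a v : inVV v -> inVV (a *: v).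
Proof. by move=> vV; rewrite -[_ *: _]addr0; apply: inVV_lin.2 => //; case: inVV_lin. Qed.

Lemma inVVN v : inVV v -> inVV (- v).
Proof. by move=> vV; rewrite -scaleN1r; apply: inVVZ. Qed.

Lemma inVV_hprod v w : inV v -> inV w -> inVV (hprod v w).
Proof.
move=> vV wV; exists 1%N, (fun=> 1), (fun=> v), (fun=> w).
by rewrite big_ord1 scale1r.
Qed.

(** Built on [harm] so that the empty [s] acts as the identity on [phi] too. *)
Definition opH (s : seq nat) : Vtilde -> Vtilde := fglift (fun nu : mindex => harm s nu).
HB.instance Definition _ s := GRing.Linear.copy (opH s)
  (fglift (fun nu : mindex => harm s nu)).

Lemma opH_basis s (nu : mindex) : opH s << nu >> = harm s nu.
Proof. exact: fglift1. Qed.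

Lemma opH_nil v : opH [::] v = v.
Proof.
elim/Vtilde_ind: v => [|mu]; first by_linearity.
by rewrite opH_basis harm_nill mi_id.
Qed.

Lemma opH_phi s : opH s << phi >> = << mi s >>.
Proof. by rewrite opH_basis harm_nilr. Qed.

Lemma opH_cons a s b v : opH (a :: s) (prepend b.+1 v) =
  prepend a (opH s (prepend b.+1 v)) + prepend b.+1 (opH (a :: s) v)
  + prepend (a + b.+1)%N (opH s v).
Proof.
elim/Vtilde_ind: v => [|mu].
  split=> [|c v w Hv Hw]; first by rewrite !linear0 !addr0.
  by rewrite !linearP /= Hv Hw !scalerDr addrACA [X in X + _]addrACA.
by rewrite prepend_basis !opH_basis parts_mi ?(valP mu) // harm_cons.
Qed.

Lemma inVV_opH s v : allpos s -> s != [::] -> inV v -> inVV (opH s v).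
Proof.
move=> s_pos s0; have sE : mi s = s :> seq nat by rewrite miE.
have mu0 : mi s != phi by apply: contraNneq s0 => s_phi; rewrite -sE s_phi.
move: v; apply: inV_ind0 => [|nu nu0].
  split=> [|a v w Hv Hw]; first by rewrite linear0; apply: inVV_lin.1.
  by rewrite linearP; apply: inVV_lin.2.
have -> : opH s << nu >> = hprod << mi s >> << nu >>.
  by rewrite /hprod !fglift1 hprod_basisE // sE opH_basis.
by apply: inVV_hprod; apply: inV_basis.
Qed.

(** All ways of merging adjacent entries, with [b] accumulating the first block. *)
Fixpoint coarsen_seq b be : Vtilde :=
  if be is c :: be' then prepend b (coarsen_seq c be') + coarsen_seq (b + c)%N be'
  else << mi [:: b] >>.

(* In terms of nested sums, with larger indices first: [al] is a strict chain, *)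
(* [coarsen_seq] of [be] a weak one, and [peak al b be] collects the terms in  *)
(* which the index of [b] lies above both. Multiplying the chains [a :: al]    *)
(* and [b :: be], either the index of [a] is at least that of [b], or it is    *)
(* smaller; this is [opH_coarsen_seq].                                         *)
Fixpoint peak al b be : Vtilde :=
  if be is c :: be' then prepend b (opH al (coarsen_seq c be')) + peak al (b + c)%N be'
  else prepend b << mi al >>.

Lemma opH_coarsen_seq a al b be : allpos (b :: be) ->
  opH (a :: al) (coarsen_seq b be) = peak al a (b :: be) + peak (a :: al) b be.
Proof.
elim: be b => [|c be IH] b /=; case: b => // b.
  move=> _; rewrite -[<< mi [:: _] >>]prepend_mi opH_cons !opH_phi.
  by rewrite addrAC.
case: c => // c be_pos; rewrite linearD /= opH_cons (IH (b.+1 + c.+1)%N) //=.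
rewrite [opH al (_ + _)]linearD.
rewrite [prepend a (_ + _)]linearD /= addnA -!addrA; congr (_ + _).
rewrite addrCA [RHS]addrCA; congr (_ + _); rewrite addrCA; congr (_ + _).
exact: addrCA.
Qed.

Lemma peak_nil b be : peak [::] b be = coarsen_seq b be.
Proof.
by elim: be b => [|c be IH] b /=; rewrite ?prepend_mi // opH_nil IH.
Qed.

Lemma inV_coarsen_seq b be : inV (coarsen_seq b.+1 be).
Proof.
elim: be b => [|c be IH] b /=; first by apply: inV_basis; apply: mi_neq0.
by rewrite addSn; apply: inVD => //; apply: inV_prepend.
Qed.

(** Modulo products, [opH_coarsen_seq] trades [peak al b (c :: be)] for minus [peak (b :: al) c be].
    Iterating until [be] is exhausted reverses it onto [al]. *)
Lemma peak_mod al b be : allpos (b :: al) -> allpos be ->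
  inVV (peak al b be - (-1) ^+ size be *: << mi (catrev be (b :: al)) >>).
Proof.
elim: be al b => [|c be IH] al b al_pos be_pos.
  by rewrite /= prepend_mi scale1r subrr; apply: inVV_lin.1.
have /andP[c_gt0 be_pos'] := be_pos.
have -> : peak al b (c :: be) = opH (b :: al) (coarsen_seq c be) - peak (b :: al) c be.
  by rewrite opH_coarsen_seq // addrK.
rewrite /= exprS mulN1r scaleNr opprK -addrA; apply: inVVD.
  by apply: inVV_opH => //; case: c c_gt0 {be_pos} => // c _; apply: inV_coarsen_seq.
rewrite addrC -opprB; apply: inVVN; apply: IH => //.
by move: al_pos; rewrite /= c_gt0.
Qed.

(** Complementing cut sets turns refinement into coarsening; on words, x is kept and y becomes x +
    y, except for the last letter. *)
Definition coarsen v := star (u (star v)).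

Lemma coarsen_opX v : inV v -> coarsen (opX v) = opX (coarsen v).
Proof.
move=> vV; have usV := inV_u (inV_star vV).
by rewrite /coarsen star_opX // u_opY star_opY.
Qed.

Lemma coarsen_opY v : inV v -> coarsen (opY v) = opZ (coarsen v).
Proof.
move=> vV; have sV := inV_star vV; have usV := inV_u sV.
by rewrite /coarsen star_opY // u_opX // /opZ linearD /= star_opX // star_opY // addrC.
Qed.

Lemma coarsen_seqS b be : coarsen_seq b.+2 be = opX (coarsen_seq b.+1 be).
Proof.
elim: be b => [|c be IH] b /=; first by rewrite opX_mi.
by rewrite linearD /= opX_prepend !addSn IH.
Qed.

Lemma coarsenE b be :
  allpos be -> coarsen << mi (b.+1 :: be) >> = coarsen_seq b.+1 be.
Proof.
elim: be b => [|c be IH] b.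
  move=> _; elim: b => [|b IHb].
    by rewrite /coarsen -prepend_mi star_base u_base star_base prepend_mi.
  rewrite -opX_mi coarsen_opX ?IHb ?coarsen_seqS //.
  by apply: inV_basis; apply: mi_neq0.
move=> /= /andP[]; case: c => // c _ be_pos; elim: b => [|b IHb].
  rewrite -prepend_mi coarsen_opY; last by apply: inV_basis; apply: mi_neq0.
  by rewrite IH // /opZ add1n coarsen_seqS addrC.
rewrite -opX_mi coarsen_opX; last by apply: inV_basis; apply: mi_neq0.
by rewrite IHb linearD /= opX_prepend !addSn coarsen_seqS.
Qed.

(** The case of an empty strict chain in [peak_mod]: the coarsenings of mu sum to (-1)^(l(mu) - 1)
    times the reversed mu, and [sigma] contributes (-1)^l(mu). *)
Lemma antipode v : inV v -> inVV (coarsen (sigma v) + tau v).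
Proof.
move: v; apply: inV_ind0 => [|mu /mindexP [b [be [_ be_pos ->]]]].
  split=> [|a v w Hv Hw].
    by rewrite /coarsen !linear0 addr0; apply: inVV_lin.1.
  by rewrite /coarsen !linearP /= addrACA -scalerDr; apply: inVV_lin.2.
rewrite sigma_basis tau_basis !parts_mi //= exprS mulN1r scaleNr.
rewrite /coarsen !linearN !linearZ /= -/(coarsen _) coarsenE // -peak_nil.
have := @peak_mod [::] b.+1 be isT be_pos.
set c := (-1) ^+ size be => VV.
have -> : << mi (rev (b.+1 :: be)) >> = c *: (c *: << mi (catrev be [:: b.+1]) >>) :> Vtilde.
  by rewrite scalerA -expr2 sqrr_sign scale1r.
by rewrite -scalerDr addrC -opprB; apply: inVVZ; apply: inVVN.
Qed.

(** Before the last letter both sides substitute -y for x and -(x + y) for y; both send the last y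
    to -y. *)
Lemma coarsen_sigma_u v : inV v -> coarsen (sigma (u v)) = u (star (wsign v)).
Proof.
move: v; apply: inV_ind => [||v vV IH|v vV IH].
- by rewrite /coarsen; by_linearity.
- rewrite u_base sigma_opY wsign_opY sigma_phi wsign_phi /coarsen !linearN /=.
  by rewrite !(star_base, u_base).
- have [suV sV] := (inV_sigma (inV_u vV), inV_star (inV_wsign vV)).
  have eV := inV_wsign vV.
  rewrite u_opY sigma_opY wsign_opY /coarsen !linearN /= -/(coarsen _) coarsen_opY // IH.
  by rewrite star_opY // u_opX.
have [suV sV] := (inV_sigma (inV_u vV), inV_star (inV_wsign vV)).
have eV := inV_wsign vV.
rewrite u_opX // /opZ linearD /= sigma_opX sigma_opY wsign_opX.
rewrite /coarsen !linearB /= -!/(coarsen _).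
rewrite coarsen_opX // coarsen_opY // IH /opZ opprD addNKr !linearN /= star_opX //.
by rewrite u_opY.
Qed.

Lemma u_tau_mod v : inV v -> inVV (u (star (wsign v)) + u (tau v)).
Proof.
by move=> vV; rewrite -coarsen_sigma_u // -tau_u //; apply: antipode; apply: inV_u.
Qed.

(** * Harmonic products with powers of y *)

Definition ones r := nseq r 1%N.
Arguments ones : simpl never.
Notation opN r := (opH (ones r)).

Lemma opN_opY r v :
  opN r.+1 (opY v) = opY (opN r (opY v)) + opY (opN r.+1 v) + opX (opY (opN r v)).
Proof. by rewrite opX_prepend -opH_cons. Qed.

(** Compare the quasi-shuffle recursion for a first entry raised by one with x applied to the
    original recursion. They differ only in the term where the leading 1 of (1^(r+1)) stays in
    front. *)
Lemma opN_opX r v : inV v ->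
  opN r.+1 (opX v) = opY (opN r (opX v)) + opX (opN r.+1 v) - opX (opY (opN r v)).
Proof.
move: v; apply: inV_ind0 => [|mu /mindexP [a [s [_ s_pos ->]]]].
  split=> [|a v w Hv Hw]; first by rewrite !linear0 !addr0.
  by rewrite !linearP /= Hv Hw !scalerDr addrACA [X in X + _]addrACA.
have -> : ones r.+1 = 1%N :: ones r by [].
rewrite -prepend_mi opX_prepend; move: (ones r) => o; rewrite !opH_cons.
rewrite [opX (_ + _)]linearD /= [opX (_ + _)]linearD /= !opX_prepend -!addrA.
by congr (_ + _); rewrite [RHS]addrC -addrA subrK.
Qed.

(** The terms x y of [opN_opX] and [opN_opY] cancel, so the combination x + y has the simpler
    recursion. *)
Lemma opN_opZ r v : inV v -> opN r.+1 (opZ v) = opZ (opN r.+1 v) + opY (opN r (opZ v)).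
Proof.
move=> vV; rewrite /opZ !linearD /= opN_opX // opN_opY.
set yx := opY (opN r (opX v)); set yy := opY (opN r (opY v)); set xy := opX (opY _).
set x := opX _; set y := opY (opN r.+1 v).
by rewrite addrA [_ - xy + _]addrAC subrK addrACA addrC.
Qed.

(** The coefficient of t^r in the harmonic product of the series of the (-t)^i (1^i) with that of
    the f(j) t^j. *)
Definition conv (f : nat -> Vtilde) r : Vtilde :=
  \sum_(i < r.+1) (-1) ^+ i *: opN i (f (r - i)%N).

Lemma eq_conv f g : f =1 g -> conv f =1 conv g.
Proof. by move=> fg r; apply: eq_bigr => i _; rewrite fg. Qed.

Lemma conv0 f : conv f 0 = f 0%N.
Proof. by rewrite /conv big_ord1 scale1r opH_nil. Qed.

(** For generating series: G = F + t H is preserved by multiplication with a fixed series. *)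
Lemma conv_shift f g h : g 0%N = f 0%N -> (forall j, g j.+1 = f j.+1 + h j) ->
  forall r, conv g r.+1 = conv f r.+1 + conv h r.
Proof.
move=> g0 gS r; rewrite /conv [LHS]big_ord_recr /= subnn g0.
rewrite [in RHS]big_ord_recr /= subnn addrAC; congr (_ + _).
rewrite -big_split; apply: eq_bigr => i _ /=.
by rewrite (subSn (leq_ord i)) gS linearD scalerDr.
Qed.

Lemma conv_opZ f r : (forall j, inV (f j)) ->
  conv (opZ \o f) r.+1 = opZ (conv f r.+1) - opY (conv (opZ \o f) r).
Proof.
move=> fV; rewrite /conv !linear_sum /= [LHS]big_ord_recl [in RHS]big_ord_recl /=.
rewrite !expr0 !scale1r !opH_nil -[RHS]addrA; congr (_ + _).
rewrite -big_split; apply: eq_bigr => i _; rewrite /bump /= subSS add1n.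
rewrite opN_opZ // scalerDr; congr (_ + _); first by rewrite linearZ.
by rewrite linearZ /= exprS mulN1r scaleNr.
Qed.

Lemma conv_opY f r :
  conv (opY \o f) r.+1 =
    opY (conv f r.+1) - opY (conv (opY \o f) r) - opX (opY (conv f r)).
Proof.
rewrite /conv !linear_sum /= [LHS]big_ord_recl [in RHS]big_ord_recl /=.
rewrite !expr0 !scale1r !opH_nil -!addrA; congr (_ + _).
rewrite -!big_split; apply: eq_bigr => i _; rewrite /bump /= subSS add1n.
rewrite opN_opY -addrA addrCA scalerDr; congr (_ + _); first by rewrite linearZ.
rewrite exprS mulN1r scaleNr scalerDr opprD; congr (- _ - _).
  by rewrite [in RHS]linearZ.
by rewrite [opY (_ *: _)]linearZ /= [in RHS]linearZ.
Qed.

Definition uO v r := u (opO r v).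

Lemma inV_uO v r : inV v -> inV (uO v r).
Proof. by move=> vV; apply: inV_u; apply: inV_opO. Qed.

Lemma uO_opX v r : inV v -> uO (opX v) r = opZ (uO v r).
Proof. by move=> vV; rewrite /uO opO_opX u_opX //; apply: inV_opO. Qed.

Lemma uO_opY v r : uO (opY v) r.+1 = opY (uO v r.+1) + opZ (uO (opY v) r).
Proof.
rewrite /uO opO_opY linearD /= u_opY u_opX //.
by apply: inV_opO; apply: inV_prepend.
Qed.

Lemma conv_uO_opX v r : inV v ->
  conv (uO (opX v)) r.+1 = opZ (conv (uO v) r.+1) - opY (conv (uO (opX v)) r).
Proof.
move=> vV; rewrite !(eq_conv (fun j => uO_opX j vV)) conv_opZ // => j.
exact: inV_uO.
Qed.

(** With F and G the series of [uO v] and [uO (opY v)], [uO_opY] says G = y F + t (x + y) G.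
    Convolving this creates correction terms, and they cancel. *)
Lemma conv_uO_opY v r : conv (uO (opY v)) r = opY (conv (uO v) r).
Proof.
have YV j : inV (uO (opY v) j) by apply: inV_uO; apply: inV_prepend.
have uOS r' : conv (uO (opY v)) r'.+1 =
    conv (opY \o uO v) r'.+1 + conv (opZ \o uO (opY v)) r'.
  apply: conv_shift => [|j]; last exact: uO_opY.
  by rewrite /uO !opO0 /= opO0 u_opY.
elim: r => [|r IH]; first by rewrite !conv0 /uO !opO0 u_opY.
(* The right side consists of the two terms that [conv_opY] subtracts. *)
suff H : conv (opZ \o uO (opY v)) r =
    opY (conv (opY \o uO v) r) + opX (opY (conv (uO v) r)).
  by rewrite uOS conv_opY H -[_ - _ - _]addrA -opprD subrK.
case: r IH => [|r] IH.
  by rewrite !conv0 /= /uO !opO0 u_opY addrC.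
have YE : opY (opY (conv (uO v) r.+1)) =
    opY (conv (opY \o uO v) r.+1) + opY (conv (opZ \o uO (opY v)) r).
  by rewrite -IH uOS linearD.
by rewrite conv_opZ // IH /opZ YE addrA addrK addrC.
Qed.

Fact uO_is_linear a v w r : uO (a *: v + w) r = a *: uO v r + uO w r.
Proof. by rewrite /uO !linearP. Qed.

Lemma conv_uO_lin a v w r :
  conv (uO (a *: v + w)) r = a *: conv (uO v) r + conv (uO w) r.
Proof.
rewrite /conv scaler_sumr -big_split; apply: eq_bigr => i _ /=.
by rewrite uO_is_linear linearP scalerDr !scalerA mulrC.
Qed.

Lemma conv_uO0 r : conv (uO 0) r = 0.
Proof. by apply: big1 => i _; rewrite /uO !linear0. Qed.

Lemma conv_uO_phi r : conv (uO << phi >>) r = (-1) ^+ r *: << mi (ones r) >>.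
Proof.
rewrite /conv big_ord_recr /= subnn /uO opO0 u_phi opH_phi big1 ?add0r // => i _.
by rewrite -(@subnSK i r) // opO_phi !linear0.
Qed.

(** O_{u(r)} sends (1) to (r+1), whose dual (1^(r+1)) is the finest composition and is fixed by
    u. *)
Lemma u_star_opO_base r : u (star (opO r (opY << phi >>))) = opY << mi (ones r) >>.
Proof.
elim: r => [|r IH]; first by rewrite opO0 star_base u_base.
rewrite opO_opY opO_phi linear0 add0r star_opX; last by apply: inV_opO; apply: inV_prepend.
by rewrite u_opY IH prepend_mi.
Qed.

(** Both sides satisfy the same recursion on the letters of v, for all r at once. *)
Lemma conv_uO v r : inV v ->
  conv (uO v) r = (-1) ^+ r *: u (star (opO r (star v))).
Proof.
move=> vV; elim/inV_ind: v / vV r => [||v vV IH|v vV IH].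
- split=> [r|a v w Hv Hw r]; first by rewrite conv_uO0 !linear0.
  by rewrite conv_uO_lin Hv Hw !linearP.
- by move=> r; rewrite conv_uO_opY conv_uO_phi star_base u_star_opO_base linearZ.
- move=> r; have sV := inV_star vV; have OsV := inV_opO r sV.
  by rewrite conv_uO_opY IH star_opY // opO_opX star_opX // u_opY linearZ.
(* For a leading x the recursion also involves the same word at degree r, so an inner induction on r
   is required. *)
have sV := inV_star vV; elim=> [|r IHr].
  by rewrite conv0 /uO !opO0 starK ?scale1r //; apply: inV_opX.
have OsV := inV_opO r.+1 sV; have sOsV := inV_star OsV.
have OYsV : inV (opO r (opY (star v))) by apply: inV_opO; apply: inV_prepend.
rewrite conv_uO_opX // IH IHr star_opX // opO_opY linearD /= star_opY // star_opX //.
rewrite linearD /= u_opX // u_opY scalerDr; congr (_ + _); first by rewrite linearZ.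
by rewrite [opY _]linearZ exprS mulN1r scaleNr.
Qed.

(** In [conv] the term i = 0 is u O_{u(r)}(v), and each other term is a product with (1^i), i >
    0. *)
Lemma uO_mod v r : inV v ->
  inVV (u (opO r v) - (-1) ^+ r *: u (star (opO r (star v)))).
Proof.
move=> vV; rewrite -conv_uO // /conv big_ord_recl expr0 scale1r opH_nil /= subn0.
rewrite opprD addrA subrr add0r; apply: inVVN.
apply: lin_closed_sum inVV_lin _ => i _; apply: inVVZ; apply: inVV_opH => //.
  by rewrite /allpos all_nseq orbT.
exact: inV_uO.
Qed.

(** * Signs and the final combination *)

(** As a substitution u sigma sends x to x + y and y to -y, which squares to the identity. *)
Lemma u_sigmaK v : inV v -> u (sigma (u (sigma v))) = v.
Proof.
move: v; apply: inV_ind => [||v vV IH|v vV IH]; first by_linearity.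
- rewrite sigma_opY sigma_phi [u (- _)]linearN /= [sigma (- _)]linearN /= u_base.
  by rewrite sigma_opY sigma_phi opprK u_base.
- rewrite sigma_opY [u (- _)]linearN /= [sigma (- _)]linearN /= u_opY.
  by rewrite sigma_opY opprK u_opY IH.
have [sV usV] := (inV_sigma vV, inV_u (inV_sigma vV)).
rewrite sigma_opX u_opX // /opZ linearD /= sigma_opX sigma_opY linearB /=.
by rewrite u_opX ?u_opY ?IH; [rewrite /opZ addrK|apply: inV_sigma].
Qed.

(** For nonempty mu, the lengths of mu and its dual add up to |mu| + 1. *)
Lemma sigma_star v : inV v -> sigma (star v) = - star (wsign (sigma v)).
Proof.
move: v; apply: inV_ind => [||v vV IH|v vV IH]; first by_linearity.
- rewrite star_base sigma_opY sigma_phi [wsign (- _)]linearN /= wsign_opY.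
  by rewrite wsign_phi opprK star_base.
- have eV := inV_wsign (inV_sigma vV).
  rewrite star_opY // sigma_opX IH sigma_opY [wsign (- _)]linearN /= wsign_opY opprK.
  by rewrite star_opY // linearN.
have eV := inV_wsign (inV_sigma vV).
rewrite star_opX // sigma_opY IH sigma_opX wsign_opX [star (- _)]linearN /= opprK.
by rewrite star_opX // linearN opprK.
Qed.

Lemma sigma_tau v : sigma (tau v) = tau (sigma v).
Proof.
elim/Vtilde_ind: v => [|mu]; first by_linearity.
rewrite tau_basis !sigma_basis miE ?allpos_rev ?(valP mu) // size_rev.
by rewrite linearZ /= tau_basis.
Qed.

Theorem corollary8p12 (r : nat) (v : Vtilde) (hv : inV v) :
  exists2 x : Vtilde, inVV x &
    O_op (u << mi [:: r] >>) (tau v - star v) = u (sigma x).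
Proof.
rewrite -/(opO r _); set y := opO r _.
have yV : inV y.
  by apply: inV_opO; apply: inVD; [apply: inV_tau|apply: inVN; apply: inV_star].
exists (u (sigma y)); last by rewrite u_sigmaK.
pose w := sigma v; have wV : inV w := inV_sigma hv.
have eV := inV_wsign wV; have seV := inV_star eV.
have yE : u (sigma y) = u (opO r (tau w)) + u (opO r (star (wsign w))).
  rewrite -opO_sigma linearB /= sigma_star // sigma_tau opprK.
  by rewrite !linearD.
(* One congruence is taken at star(eps w), where [starK] removes the double star, the other at
   O_{u(r)}(w). The common term (-1)^r u star O_{u(r)}(eps w) cancels in their sum. *)
have := uO_mod r seV; have := u_tau_mod (inV_opO r wV).
rewrite starK // opO_wsign linearZ /= linearZ /= yE -opO_tau => H1 H2.
by have := inVVD H1 H2; rewrite addrC addrA addrNK addrC.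
Qed.
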